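(* Thompson's group $V$ is of non-uniform exponential growth. That is, $V$ has exponential growth and its infimal exponential growth rate satisfies $\omega(V)=1$.
   Context: For a group $G$ with finite generating set $S$, let $\gamma_G^S(n)$ be the number of elements of $G$ that can be represented by words of length at most $n$ over $S\cup S^{-1}$. The exponential growth rate is $\omega(G,S)=\lim_{n\to\infty}\sqrt[n]{\gamma_G^S(n)}$ (the limit always exists). $G$ has exponential growth if $\omega(G,S)>1$ for one (equivalently every) finite generating set $S$. The infimal exponential growth rate is $\omega(G)=\inf_S\omega(G,S)$, the infimum over all finite generating sets $S$ of $G$. $G$ has non-uniform exponential growth if $G$ is finitely generated, has exponential growth, and $\omega(G)=1$. Let $\mathfrak{C}=\{0,1\}^{\mathbb{N}}$ be the Cantor set of infinite binary sequences and $\{0,1\}^*$ the set of finite binary words. For $w\in\{0,1\}^*$ let $w\mathfrak{C}=\{w\xi\mid \xi\in\mathfrak{C}\}$. A finite set $A\subseteq\{0,1\}^*$ is a dyadic partition set if $\mathfrak{C}=\bigsqcup_{w\in A}w\mathfrak{C}$. Thompson's group $V$ is the subgroup of $\mathrm{Homeo}(\mathfrak{C})$ consisting of those homeomorphisms $\gamma$ for which there are dyadic partition sets $A,B$ of the same cardinality and a bijection $f\colon A\to B$ with $\gamma(w\xi)=f(w)\xi$ for all $w\in A$, $\xi\in\mathfrak{C}$. *)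

(* Defs.v *)
From HB Require Import structures.
From mathcomp Require Import all_boot all_order all_algebra finmap.
From mathcomp Require Import boolp classical_sets functions cardinality reals.
From mathcomp Require Import topology normedtype sequences exp cantor.

Set Implicit Arguments.
Unset Strict Implicit.
Unset Printing Implicit Defensive.

Import numFieldNormedType.Exports.

Local Open Scope classical_set_scope.

Section Growth.
Variable G : groupType.
Local Open Scope group_scope.
Implicit Type S : {fset G}.

Definition word_over S (w : seq G) : bool :=
  all (fun s => (s \in S) || (s^-1 \in S)) w.

Definition generating S : Prop :=
  forall g : G, exists2 w, word_over S w & g = \prod_(s <- w) s.

Definition finitely_generated : Prop := exists S, generating S.

Definition word_ball S (n : nat) : set G :=
  [set g | exists w, [/\ word_over S w, (size w <= n)%N & g = \prod_(s <- w) s]].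

(* Ensures that the cardinal in [growth] is the intended one: [fset_set] returns
   the empty set on infinite sets. *)
Lemma finite_word_ball S n : finite_set (word_ball S n).
Proof.
elim: n => [|n IHn].
  apply: (@sub_finite_set _ _ [set 1]) => // g [[|s w] [//= _ _ ->]].
  by rewrite big_nil.
pose T := [set` S] `|` (fun s : G => s^-1) @` [set` S].
have finT : finite_set T.
  by rewrite finite_setU; split=> //; apply: finite_image.
pose P := [set s * g | s in T & g in word_ball S n] `|` [set 1].
apply: (@sub_finite_set _ _ P); last first.
  by rewrite finite_setU; split=> //; apply: finite_image2.
move=> g [[|s w] [/= Sw lew ->]]; first by right; rewrite big_nil.
case/andP: Sw => Ss Sw; left; exists s; last first.
  by exists (\prod_(s <- w) s); [exists w | rewrite big_cons].
by case/orP: Ss => Ss; [left | right; exists s^-1; rewrite ?invgK].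
Qed.

Definition growth S (n : nat) : nat := #|` fset_set (word_ball S n)|.

Variable R : realType.
Local Open Scope ring_scope.

Definition growth_rate S : R :=
  limn (fun n => (growth S n)%:R `^ (n%:R^-1)).

Definition exponential_growth : Prop :=
  exists2 S, generating S & 1 < growth_rate S.

Definition infimal_growth_rate : R :=
  inf [set growth_rate S | S in generating].

Definition nonuniform_exponential_growth : Prop :=
  [/\ finitely_generated, exponential_growth & infimal_growth_rate = 1].

End Growth.

Section Homeo.
Variable X : topologicalType.

Record homeo := Homeo {
  homeo_fun :> X -> X;
  homeo_inv : X -> X;
  homeo_funK : cancel homeo_fun homeo_inv;
  homeo_invK : cancel homeo_inv homeo_fun;
  homeo_fun_continuous : continuous homeo_fun;
  homeo_inv_continuous : continuous homeo_inv }.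

Lemma homeoP (g h : homeo) : g =1 h -> g = h.
Proof.
case: g h => [g g' gK g'K cg cg'] [h h' hK h'K ch ch'] /= /funext eqgh.
subst h.
have eqgh' : g' = h' by apply/funext => x; rewrite -{1}(h'K x) gK.
by subst h'; congr Homeo; apply: Prop_irrelevance.
Qed.

HB.instance Definition _ := gen_eqMixin homeo.
HB.instance Definition _ := gen_choiceMixin homeo.

Definition homeo1 : homeo.
Proof. by apply: (@Homeo id id) => // x; apply: cvg_id. Defined.

Definition homeoV (g : homeo) : homeo :=
  Homeo (homeo_invK g) (homeo_funK g)
    (@homeo_inv_continuous g) (@homeo_fun_continuous g).

Definition homeoM (g h : homeo) : homeo.
Proof.
apply: (@Homeo (g \o h) (homeo_inv h \o homeo_inv g)).
- exact: can_comp (homeo_funK g) (homeo_funK h).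
- exact: can_comp (homeo_invK h) (homeo_invK g).
- move=> x; apply: continuous_comp; exact: homeo_fun_continuous.
- move=> x; apply: continuous_comp; exact: homeo_inv_continuous.
Defined.

Lemma homeoA : associative homeoM.
Proof. by move=> f g h; apply: homeoP. Qed.
Lemma homeo1M : left_id homeo1 homeoM.
Proof. by move=> g; apply: homeoP. Qed.
Lemma homeoM1 : right_id homeo1 homeoM.
Proof. by move=> g; apply: homeoP. Qed.
Lemma homeoVM : left_inverse homeo1 homeoV homeoM.
Proof. by move=> g; apply: homeoP => x; apply: homeo_funK. Qed.
Lemma homeoMV : right_inverse homeo1 homeoV homeoM.
Proof. by move=> g; apply: homeoP => x; apply: homeo_invK. Qed.

HB.instance Definition _ :=
  isGroup.Build homeo homeoA homeo1M homeoM1 homeoVM homeoMV.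

End Homeo.

(* The concatenation of the finite word [w] and the infinite word [xi]. *)
Definition prepend (w : seq bool) (xi : cantor_space) : cantor_space :=
  fun n => nth (xi (n - size w)) w n.

Definition cone (w : seq bool) : set cantor_space := range (prepend w).

Definition dyadic_partition (A : {fset seq bool}) : Prop :=
  \bigcup_(w in [set` A]) cone w = setT /\ trivIset [set` A] cone.

Definition dyadic_homeo (g : homeo cantor_space) : Prop :=
  exists A B : {fset seq bool},
    [/\ dyadic_partition A, dyadic_partition B, #|` A| = #|` B| &
      exists2 f : seq bool -> seq bool, set_bij [set` A] [set` B] f &
        forall w xi, w \in A -> g (prepend w xi) = prepend (f w) xi].

Lemma prepend_cat v w xi : prepend (v ++ w) xi = prepend v (prepend w xi).
Proof.
apply/funext => n; rewrite /prepend nth_cat size_cat subnDA.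
by case: ltnP => // lt_n; [apply: set_nth_default | rewrite [RHS]nth_default].
Qed.

Lemma prepend_eq v w xi eta : (size v <= size w)%N ->
  prepend v xi = prepend w eta -> v = take (size v) w.
Proof.
move=> le_vw eq_vw; apply: (@eq_from_nth _ false) => [|n lt_n].
  by rewrite size_takel.
have := congr1 (fun x : cantor_space => x n) eq_vw.
rewrite /prepend nth_take // (set_nth_default false) // => ->.
by apply: set_nth_default; apply: leq_trans le_vw.
Qed.

Lemma prepend_prefix (xi : cantor_space) N :
  xi = prepend (mkseq xi N) (fun n => xi (N + n)%N).
Proof.
apply/funext => n; rewrite /prepend size_mkseq; have [lt_n|le_n] := ltnP n N.
  by rewrite nth_mkseq.
by rewrite nth_default ?size_mkseq // subnKC.
Qed.

(* Equivalent to [dyadic_homeo] but visibly stable under composition. *)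
Definition uniform_homeo (g : homeo cantor_space) : Prop :=
  exists N, forall u, size u = N ->
    exists u', forall xi, g (prepend u xi) = prepend u' xi.

Lemma dyadic_homeo_uniform g : dyadic_homeo g -> uniform_homeo g.
Proof.
case=> A [B [[Acov _] _ _ [f _ gf]]].
exists (\max_(w <- A) size w) => u size_u.
have : [set: cantor_space] (prepend u (fun=> false)) by [].
rewrite -Acov => -[w /= wA [xi _ eq_wu]].
have le_wu : (size w <= size u)%N by rewrite size_u; apply: leq_bigmax_seq.
exists (f w ++ drop (size w) u) => eta.
rewrite prepend_cat -gf // -prepend_cat; congr (g (prepend _ eta)).
by rewrite -[LHS](cat_take_drop (size w)) -(prepend_eq le_wu eq_wu).
Qed.

Lemma uniform_homeo_dyadic g : uniform_homeo g -> dyadic_homeo g.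
Proof.
case=> N gN.
have /choice[f gf] : forall u, exists u', size u = N ->
    forall xi, g (prepend u xi) = prepend u' xi.
  move=> u; have [/eqP/gN[u' gu]|neq_u] := boolP (size u == N); first by exists u'.
  by exists [::] => eq_u; rewrite eq_u eqxx in neq_u.
pose A : {fset seq bool} := [fset val t | t in {: N.-tuple bool}]%fset.
have inA u : (u \in A) = (size u == N).
  apply/imfsetP/eqP => [[t _ ->]|size_u]; first exact: size_tuple.
  by exists (tcast size_u (in_tuple u)) => //=; rewrite val_tcast.
have Ainj u v xi eta : u \in A -> v \in A ->
    prepend u xi = prepend v eta -> u = v.
  rewrite !inA => /eqP su /eqP sv /prepend_eq.
  by rewrite su sv => /(_ (leqnn N)) ->; rewrite take_oversize ?sv.
have finj : {in A &, injective f}.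
  move=> u v uA vA eqf; apply: (Ainj u v (fun=> false) (fun=> false)) => //.
  apply: (can_inj (homeo_funK g)).
  by rewrite !gf ?eqf //; apply/eqP; rewrite -inA.
exists A, (f @` A)%fset; split.
- split=> [|u v /= uA vA [_ [[xi _ <-] [eta _ eq_uv]]]]; last first.
    by apply: (Ainj u v xi eta) => //; rewrite eq_uv.
  apply/seteqP; split=> // xi _; exists (mkseq xi N).
    by rewrite /= inA size_mkseq.
  by exists (fun n => xi (N + n)%N) => //; rewrite -prepend_prefix.
- split.
    apply/seteqP; split=> // eta _.
    set xi := homeo_inv g eta.
    have xA : mkseq xi N \in A by rewrite inA size_mkseq.
    exists (f (mkseq xi N)); first by rewrite /= in_imfset.
    exists (fun n => xi (N + n)%N) => //.
    by rewrite -gf ?size_mkseq // -prepend_prefix homeo_invK.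
  move=> _ _ /= /imfsetP[u /= uA ->] /imfsetP[v /= vA ->].
  move=> [_ [[xi _ <-] [eta _ eq_uv]]]; congr f.
  apply: (Ainj u v xi eta) => //; apply: (can_inj (homeo_funK g)).
  by rewrite !gf ?eq_uv //; apply/eqP; rewrite -inA.
- by rewrite [RHS]card_in_imfset //=; apply: finj.
- exists f; last by move=> w xi; rewrite inA => /eqP/gf.
  split=> [u /= uA|u v /set_mem/= uA /set_mem/= vA|_ /= /imfsetP[u /= uA ->]].
  + by rewrite in_imfset.
  + exact: finj.
  + by exists u.
Qed.

Lemma dyadic_homeo1 : dyadic_homeo 1%g.
Proof. by apply: uniform_homeo_dyadic; exists 0%N => u _; exists u. Qed.

Lemma dyadic_homeoM g h :
  dyadic_homeo g -> dyadic_homeo h -> dyadic_homeo (g * h)%g.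
Proof.
move=> /dyadic_homeo_uniform[M gM] /dyadic_homeo_uniform[N hN].
apply: uniform_homeo_dyadic; exists (N + M)%N => u size_u.
have [|v hv] := hN (take N u); first by rewrite size_takel // size_u leq_addr.
set u' := v ++ drop N u.
have le_M : (M <= size u')%N by rewrite size_cat size_drop size_u addKn leq_addl.
have [|w gw] := gM (take M u'); first by rewrite size_takel.
exists (w ++ drop M u') => xi.
rewrite prepend_cat -gw -prepend_cat cat_take_drop prepend_cat -hv -prepend_cat.
by rewrite cat_take_drop.
Qed.

Lemma dyadic_homeoV g : dyadic_homeo g -> dyadic_homeo g^-1%g.
Proof.
case=> A [B [partA partB cardAB [f [fAB finj fsurj] gf]]].
have /choice[f' ff'] : forall v, exists u, v \in B -> u \in A /\ f u = v.
  move=> v; have [/fsurj[u uA fu]|vB] := boolP (v \in B); first by exists u.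
  by exists v.
exists B, A; split=> //; exists f'; last first.
  move=> v xi /ff'[uA fu]; rewrite -{1}fu -gf //; exact: homeo_funK.
split=> [v /ff'[]//|v w /set_mem/= vB /set_mem/= wB eq_f'|u /= uA].
  by have [_ <-] := ff' _ vB; have [_ <-] := ff' _ wB; rewrite eq_f'.
have fuB : f u \in B by exact: fAB.
have [u'A fu'] := ff' _ fuB; exists (f u) => //.
by apply: finj; rewrite ?inE.
Qed.

Definition thompson_pred : pred (homeo cantor_space) :=
  fun g => `[< dyadic_homeo g >].

Lemma thompson_group_closed : group_closed thompson_pred.
Proof.
split=> [|g h /asboolP gV /asboolP hV]; first exact/asboolP/dyadic_homeo1.
by apply/asboolP/dyadic_homeoM => //; apply: dyadic_homeoV.
Qed.

Record thompsonV := ThompsonV {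
  thompson_val :> homeo cantor_space;
  thompson_valP : thompson_pred thompson_val }.

HB.instance Definition _ := [isSub for thompson_val].
HB.instance Definition _ := [Choice of thompsonV by <:].
HB.instance Definition _ :=
  SubChoice_isSubGroup.Build (homeo cantor_space) thompson_pred thompsonV
    thompson_group_closed.

(* Main.v *)
(* Replace the recursion of the first Grigorchuk group at the vertex 1^m by the
   identity: this gives a copy of a finite quotient of that group in V, acting on
   the words of length m along a path with 2^m vertices. Add all swaps of cones
   u0, u10, u11 for u among the first two vertices of that path. The resulting set
   generates V: near the start of the path it contains the swaps for the partition
   0, 10, 11 of each cone, and at the other end of the path the Klein group flips
   the next letter, which does not respect this partition.

   A word much shorter than 2^m cannot see both ends. It is therefore determined by
   its image in the Grigorchuk group together with a permutation of the cones over
   its inverted orbit, that is, over the vertices whose trajectory meets a swap.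
   The contraction of the Grigorchuk group bounds both: the sections at level k of
   a word of length N have total length at most about (5/6)^k N + 2^k, and each
   letter of these accounts for at most one vertex of the inverted orbit. With
   m = 2k and N = 2^(m-2) the ball of radius N has exp(o(N)) elements. As growth is
   submultiplicative, the growth rates of these generating sets tend to 1. *)
Require Import Defs.
From mathcomp Require Import all_boot reals.
From mathcomp Require Import all_order all_algebra finmap.
From mathcomp Require Import boolp classical_sets functions cardinality.
From mathcomp Require Import topology normedtype sequences exp cantor.
From mathcomp Require Import zify.

Set Implicit Arguments.
Unset Strict Implicit.
Unset Printing Implicit Defensive.

(** * The first Grigorchuk group on finite words: sections and contraction *)

Definition klein := (bool * bool)%type.
Definition kone : klein := (false, false).
Definition kmul (x y : klein) : klein := (x.1 (+) y.1, x.2 (+) y.2).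
(** The letters [b], [c], [d] are [(true, true)], [(true, false)], [(false, true)]. The section at
    [true] is [krot x], which cycles [b], [c], [d]; the section at [false] is [a] exactly when [x.1]
    holds. *)
Definition krot (x : klein) : klein := (x.2, x.1 (+) x.2).
(* [b], [c], [d] weigh 3, 2, 1, and the letter [a] weighs 3 in [wt]. Then the
   two sections of a pair [x a] weigh together at most 5/6 of that pair. The
   identity also has a weight since identity letters are never cancelled: they
   record visits of the root. *)
Definition kwt (x : klein) : nat := (x.1 + (x.1 && x.2)).+1.

Definition wflip (v : seq bool) := if v is s :: v' then ~~ s :: v' else [::].

Fixpoint wact (x : klein) (v : seq bool) : seq bool :=
  match v with
  | [::] => [::]
  | true :: v' => true :: wact (krot x) v'
  | false :: v' => false :: (if x.1 then wflip v' else v')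
  end.

(* The list [x_0, ..., x_p] stands for the word [x_0 a x_1 a ... a x_p], read
   from left to right. It visits the root [1...1] when some [x_i] is applied
   there. *)
Fixpoint visit (xs : seq klein) (v : seq bool) : bool :=
  if xs is x :: xs' then
    (v == nseq (size v) true) ||
    (if xs' is _ :: _ then visit xs' (wflip (wact x v)) else false)
  else false.

(* The section at the letter [s] of the word represented by a list. *)
Fixpoint sec (s : bool) (xs : seq klein) : seq klein :=
  match xs with
  | [::] => [:: kone]
  | x :: xs' =>
    if s then
      let ys := sec false xs' in kmul (krot x) (head kone ys) :: behead ys
    else if x.1 then kone :: sec true xs' else sec true xs'
  end.

Definition wt (xs : seq klein) := \sum_(x <- xs) (kwt x + 3).

Lemma kmul1 : right_id kone kmul.
Proof. by move=> [[] []]. Qed.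
Lemma krotM x y : krot (kmul x y) = kmul (krot x) (krot y).
Proof. by move: x y => [[] []] [[] []]. Qed.

Lemma wflipK : involutive wflip.
Proof. by case=> //= s v; rewrite negbK. Qed.
Lemma size_wflip v : size (wflip v) = size v.
Proof. by case: v. Qed.

Lemma wactM x y v : wact (kmul x y) v = wact y (wact x v).
Proof.
elim: v x y => [|[] v IHv] x y //=; first by rewrite krotM IHv.
by case: x.1 => /=; case: y.1 => //=; rewrite wflipK.
Qed.
Lemma wact1 v : wact kone v = v.
Proof. by elim: v => //= -[v IHv|v _] //=; rewrite IHv. Qed.
Lemma wactK x : involutive (wact x).
Proof.
by move=> v; rewrite -wactM -[RHS]wact1; congr (wact _ v); case: x => [[] []].
Qed.
Lemma size_wact x v : size (wact x v) = size v.
Proof. by elim: v x => [|[] v IHv] x //=; rewrite ?IHv //; case: x.1; rewrite ?size_wflip. Qed.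
Lemma wact_root x n : wact x (nseq n true) = nseq n true.
Proof. by elim: n x => [|n IHn] x //=; rewrite IHn. Qed.

Lemma sec_cons s xs : sec s xs = head kone (sec s xs) :: behead (sec s xs).
Proof.
case: xs => //= x xs; case: s => //; case: ifP => // _.
by case: xs.
Qed.

(** At a visit of the root the current first letter is [true], so the visit is recorded by an entry
    [krot x] of the section. Merging entries loses no visit, since the Klein group fixes the
    root. *)
Lemma visit_sec s xs v : visit xs (s :: v) -> visit (sec s xs) v.
Proof.
elim: xs s v => // x xs IHxs [] v.
  move=> /=; case/orP=> [/eqP[eqv]|]; first by rewrite -eqv eqxx.
  case: xs IHxs => // y xs IHxs /IHxs /=.
  set ys := (if y.1 then _ else _); have : ys = sec false (y :: xs) by [].
  move: ys => ys eq_ys; rewrite {}eq_ys sec_cons /=.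
  case/orP=> [/eqP eqv|].
    rewrite -(wactK (krot x) v) eqv size_wact wact_root size_nseq.
    by rewrite eqxx.
  by rewrite wactM => ->; rewrite orbT.
move=> /=; case: xs IHxs => // y xs IHxs /IHxs.
case: ifP => // _ visv.
have {}visv: visit (sec true (y :: xs)) (wflip v) by [].
by move: visv; rewrite [in visit _ _]sec_cons /= wact1 => ->; rewrite orbT.
Qed.

(* The head of [sec false xs] may be an identity that no letter of [xs] pays
   for, so it must not be charged. *)
Definition hwt (x : klein) := if x == kone then 0 else kwt x.

Lemma kwt_kmul x y : kwt (kmul x y) <= kwt x + hwt y.
Proof. by move: x y => [[] []] [[] []]. Qed.
Lemma hwt_kwt x : hwt x <= kwt x <= (hwt x).+1.
Proof. by move: x => [[] []]. Qed.

Lemma wt_cons x xs : wt (x :: xs) = kwt x + 3 + wt xs.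
Proof. by rewrite /wt big_cons. Qed.
Lemma wt_nil : wt [::] = 0.
Proof. by rewrite /wt big_nil. Qed.
Lemma wt_cat xs ys : wt (xs ++ ys) = wt xs + wt ys.
Proof. by rewrite /wt big_cat. Qed.

Lemma size_wt xs : size xs <= wt xs.
Proof. by elim: xs => // x xs IHxs; rewrite wt_cons /=; lia. Qed.

Lemma wt_sec xs : 6 * (wt (sec false xs) + wt (sec true xs)) <= 5 * wt xs + 48.
Proof.
pose A s := wt (behead (sec s xs)).
have split s : wt (sec s xs) = kwt (head kone (sec s xs)) + 3 + A s.
  by rewrite [in LHS]sec_cons wt_cons.
(* The heads are charged separately because the head of [sec false xs] gets merged with the next
   letter on the left. Restoring two weights 3 and the gap between [hwt] and [kwt] costs
   [6 * 7 = 42], whence 48. *)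
have : 6 * (hwt (head kone (sec false xs)) + A false +
            (kwt (head kone (sec true xs)) + A true)) <= 5 * wt xs + 6.
  rewrite /A {split A}; elim: xs => [|x xs]; first by rewrite /= wt_nil.
  rewrite wt_cons /=; move: (hwt_kwt (head kone (sec false xs))).
  move: (kwt_kmul (krot x) (head kone (sec false xs))).
  (* The contraction factor 5/6; it is attained by [b], whose sections [c] and [a] weigh 2 + 3
     against 3 + 3. *)
  have : 6 * (kwt (krot x) + 3 * x.1) <= 5 * (kwt x + 3) by case: x => [[] []].
  case: x.1 => /= => wt_x /= le_mul.
    rewrite [in wt (sec true xs)]sec_cons wt_cons [hwt kone]/= add0n; lia.
  by move: (hwt_kwt (head kone (sec true xs))); lia.
have := hwt_kwt (head kone (sec false xs)).
by rewrite !split; lia.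
Qed.

(* The Schreier graph of the words of length [n] is a path from the root
   [1...1] to [1...10], and [wpos] (a Gray code) is the position on it. *)
Fixpoint wpos (v : seq bool) : nat :=
  if v is s :: v' then (wpos v').*2 + (~~ s (+) odd (wpos v')) else 0.

Lemma wpos_root n : wpos (nseq n true) = 0.
Proof. by elim: n => //= n ->. Qed.

Lemma wpos_flip v : wpos (wflip v) <= (wpos v).+1.
Proof. case: v => //= s v; case: s; case: (odd _) => /=; lia. Qed.

(** The edges of the path alternate: the flip joins each even position to the next one, the Klein
    group each odd position to the next one. *)
Lemma wpos_wact_eq x v : wact x v = v \/
  (if odd (wpos v) then wpos (wact x v) = (wpos v).+1
   else wpos v = (wpos (wact x v)).+1).
Proof.
elim: v x => [|[] v IHv] x /=; first by left.
  case: (IHv (krot x)) => [->|]; first by left.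
  rewrite oddD odd_double /=; case: ifP => oddv pos_eq; right.
    by rewrite pos_eq /= oddv /=; lia.
  move: oddv; rewrite pos_eq /= => /negbFE ->; rewrite /=; lia.
case: x.1; last by left.
case: v {IHv} => [|s v] /=; first by left.
right; rewrite !oddD !odd_double /=.
by case: s; case odd_v: (odd (wpos v)) => /=; lia.
Qed.

Lemma wpos_wact x v : wpos (wact x v) <= (wpos v).+1.
Proof. by case: (wpos_wact_eq x v) => [->|]; [|case: ifP]; lia. Qed.

Lemma wpos_end n : (wpos (rcons (nseq n true) false)).+1 = 2 ^ n.+1.
Proof.
elim: n => // n /= IHn; have odd_pos: odd (wpos (rcons (nseq n true) false)).
  by rewrite -[odd _]negbK -oddS IHn oddX.
by rewrite odd_pos /= expnS -IHn; lia.
Qed.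

(** * Size of inverted orbits *)

Fixpoint words n : seq (seq bool) :=
  if n is n'.+1 then map (cons false) (words n') ++ map (cons true) (words n')
  else [:: [::]].

Lemma mem_words n v : (v \in words n) = (size v == n).
Proof.
elim: n v => [|n IHn] [|s v] //=.
  by rewrite mem_cat; apply/norP; split; apply/mapP => -[].
rewrite mem_cat eqSS -IHn; apply/orP/idP => [[] /mapP[u uw [_ ->]] //|vw].
by case: s; [right|left]; rewrite map_f.
Qed.

Lemma uniq_words n : uniq (words n).
Proof.
elim: n => //= n IHn; rewrite cat_uniq !map_inj_uniq; try by move=> ? ? [].
rewrite IHn andbT /=; apply/hasPn => _ /mapP[u _ ->].
by apply/mapP => -[].
Qed.

Lemma size_words n : size (words n) = 2 ^ n.
Proof. by elim: n => //= n IHn; rewrite size_cat !size_map IHn expnS; lia. Qed.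

(** At each time the current vertex is a bijective function of the starting vertex, so each entry
    accounts for only one start. *)
Lemma count_visit xs n : count (visit xs) (words n) <= size xs.
Proof.
elim: xs => [|x xs IHxs] /=; first by rewrite (@eq_count _ _ pred0) ?count_pred0.
have le_root : count (pred1 (nseq n true)) (words n) <= 1.
  by rewrite count_uniq_mem ?uniq_words ?leq_b1.
pose f v := wflip (wact x v).
have fw: perm_eq (map f (words n)) (words n).
  have finj: injective f by move=> u v /(can_inj wflipK) /(can_inj (wactK x)).
  apply: uniq_perm; rewrite ?map_inj_uniq ?uniq_words // => v.
  rewrite mem_words; apply/mapP/eqP => [[u]|szv].
    by rewrite mem_words => /eqP <- ->; rewrite /f size_wflip size_wact.
  exists (wact x (wflip v)); last by rewrite /f wactK wflipK.
  by rewrite mem_words size_wact size_wflip szv.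
apply: leq_trans (_ : count (pred1 (nseq n true)) (words n) +
                      count (preim f (visit xs)) (words n) <= _).
  rewrite -count_predUI; apply: leq_trans (leq_addr _ _).
  pose g v := (v == nseq n true) || (if xs is _ :: _ then visit xs (f v) else false).
  apply: (@leq_trans (count g (words n))).
    rewrite leq_eqVlt; apply/orP; left; apply/eqP/eq_in_count => v.
    by rewrite mem_words => /eqP szv /=; rewrite szv.
  apply: sub_count => v /= /orP[->//|].
  by case: xs {IHxs g} => // y xs ->; rewrite orbT.
by rewrite -count_map (permP fw) -add1n leq_add.
Qed.

Fixpoint secs (u : seq bool) (xs : seq klein) : seq klein :=
  if u is s :: u' then secs u' (sec s xs) else xs.

Lemma sum_wordsS (F : seq bool -> nat) n : \sum_(u <- words n.+1) F u =
  \sum_(u <- words n) F (false :: u) + \sum_(u <- words n) F (true :: u).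
Proof. by rewrite [words _]/= big_cat /= !big_map. Qed.

(** Iteration of [wt_sec] over the [2 ^ k] vertices, with denominators cleared. The constant 7 is
    the least integer [c] with [5 * c + 48 <= 12 * c]. *)
Lemma wt_secs k xs :
  6 ^ k * (\sum_(u <- words k) wt (secs u xs)) + 7 * 5 ^ k <=
  5 ^ k * wt xs + 7 * 12 ^ k.
Proof.
elim: k xs => [|k IHk] xs; first by rewrite big_seq1 /= !mul1n.
rewrite sum_wordsS /= mulnDr !expnS.
have := wt_sec xs; have /= := IHk (sec false xs); have /= := IHk (sec true xs).
set a := \sum_(u <- _) _; set b := \sum_(u <- _) _.
move: (5 ^ k) (6 ^ k) (12 ^ k) (wt (sec _ _)) (wt (sec _ _)) => A B D w1 w2.
move=> le1 le2 lew.
have : A * (6 * (w1 + w2)) <= A * (5 * wt xs + 48) by rewrite leq_mul2l lew orbT.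
lia.
Qed.

(** By [visit_sec], the visiting words below a prefix [u] are visiting words for the section at
    [u]. *)
Lemma count_visit_secs k j xs : count (visit xs) (words (k + j)) <=
  \sum_(u <- words k) wt (secs u xs).
Proof.
elim: k xs => [|k IHk] xs.
  by rewrite big_seq1; apply: leq_trans (count_visit _ _) (size_wt _).
rewrite sum_wordsS addSn /= count_cat !count_map.
by apply: leq_add; apply: leq_trans (IHk _); apply: sub_count => v /= /visit_sec.
Qed.

Local Open Scope classical_set_scope.

(** * Continuity of prefix replacements *)

Lemma nbhs_coord (xi : cantor_space) n : nbhs xi [set eta : cantor_space | eta n = xi n].
Proof.
have := @proj_continuous nat (fun=> bool) n xi.
move=> /(_ [set b | b = xi n]); apply.
by apply: open_nbhs_nbhs; split=> //; apply: discrete_open.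
Qed.
Lemma nbhs_cylinder (xi : cantor_space) n :
  nbhs xi [set eta : cantor_space | mkseq eta n = mkseq xi n].
Proof.
elim: n => [|n IHn]; first by apply: filterS filterT.
apply: filterS (filterI IHn (nbhs_coord xi n)) => eta /= [eqn eq_n].
by rewrite !mkseqS eqn eq_n.
Qed.

Lemma uniform_continuous (f : cantor_space -> cantor_space) N :
  (forall u, size u = N -> exists u', forall xi, f (prepend u xi) = prepend u' xi) ->
  continuous f.
Proof.
move=> uf xi; apply/pointwise_cvgP => n A /= /nbhs_singleton Afx.
rewrite nbhs_filterE /=.
(* Letter [n] of the image lies in [u'] or is letter [N + (n - size u')] of the argument, so
   [N + n.+1] letters suffice. *)
apply: filterS (nbhs_cylinder xi (N + n.+1)) => eta /= eq_pre.
have [u' fu] := uf (mkseq xi N) (size_mkseq _ _).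
suff -> : f eta n = f xi n by [].
have eqN : mkseq eta N = mkseq xi N.
  have := congr1 (take N) eq_pre.
  by rewrite /mkseq -!map_take take_iota (minn_idPl (leq_addr _ _)).
rewrite (prepend_prefix xi N) (prepend_prefix eta N) eqN !fu /prepend.
have [lt_n|le_n] := ltnP n (size u'); first by apply: set_nth_default.
rewrite !nth_default //.
have := congr1 (fun s => nth false s (N + (n - size u'))) eq_pre.
by rewrite !nth_mkseq // ltn_add2l ltnS leq_subr.
Qed.

(** * Cone swaps in Thompson's group *)

Definition uniform_fun (f : cantor_space -> cantor_space) :=
  exists N, forall u, size u = N ->
    exists u', forall xi, f (prepend u xi) = prepend u' xi.

Lemma uniform_fun_continuous f : uniform_fun f -> continuous f.
Proof. by case=> N; apply: uniform_continuous. Qed.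

Definition invol_homeo f (fK : involutive f) (uf : uniform_fun f) :
    homeo cantor_space :=
  Homeo fK fK (uniform_fun_continuous uf) (uniform_fun_continuous uf).

Lemma invol_homeo_dyadic f fK uf : thompson_pred (@invol_homeo f fK uf).
Proof. exact/asboolP/uniform_homeo_dyadic. Qed.

Definition involV f (fK : involutive f) (uf : uniform_fun f) : thompsonV :=
  ThompsonV (invol_homeo_dyadic fK uf).

Lemma thompsonVP (g h : thompsonV) : g =1 h -> g = h.
Proof. by move=> eqgh; apply: val_inj; apply: homeoP. Qed.

Lemma involV_inv f fK uf : ((@involV f fK uf)^-1)%g = involV fK uf.
Proof. exact: thompsonVP. Qed.

Lemma thompson_uniform (g : thompsonV) : uniform_fun g.
Proof. exact/dyadic_homeo_uniform/asboolP/(thompson_valP g). Qed.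

Definition ctail (xi : cantor_space) : cantor_space := fun n => xi n.+1.
Definition cdrop k (xi : cantor_space) : cantor_space := fun n => xi (k + n).
Definition starts p (xi : cantor_space) := mkseq xi (size p) == p.

Lemma prepend_nil xi : prepend [::] xi = xi.
Proof. by apply/funext => n; rewrite /prepend subn0 nth_nil. Qed.

Lemma prepend_cons s v xi : prepend (s :: v) xi = prepend [:: s] (prepend v xi).
Proof. exact: (prepend_cat [:: s]). Qed.

Lemma ctail_prepend s v xi : ctail (prepend (s :: v) xi) = prepend v xi.
Proof. by apply/funext => n; rewrite /ctail /prepend /= subSS. Qed.

Lemma cantor_eta xi : prepend [:: xi 0] (ctail xi) = xi.
Proof. by rewrite [RHS](prepend_prefix xi 1). Qed.

Lemma cantor_case xi : exists s eta, xi = prepend [:: s] eta.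
Proof. by exists (xi 0), (ctail xi); rewrite cantor_eta. Qed.

Lemma cdrop_prepend p xi : cdrop (size p) (prepend p xi) = xi.
Proof.
apply/funext => n; rewrite /cdrop /prepend nth_default ?leq_addr //.
by rewrite addKn.
Qed.

Lemma startsP p xi : reflect (exists eta, xi = prepend p eta) (starts p xi).
Proof.
apply: (iffP eqP) => [eqp|[eta ->]].
  by exists (cdrop (size p) xi); rewrite {1}(prepend_prefix xi (size p)) eqp.
apply: (@eq_from_nth _ false); rewrite size_mkseq // => i lti.
by rewrite nth_mkseq // /prepend; apply: set_nth_default.
Qed.

Definition perp (p q : seq bool) := ~~ prefix p q && ~~ prefix q p.

Lemma perp_sym p q : perp p q = perp q p.
Proof. exact: andbC. Qed.

Lemma prepend_prefixes p q xi eta : prepend p xi = prepend q eta ->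
  prefix p q || prefix q p.
Proof.
move=> eqpq; rewrite !prefixE.
case/orP: (leq_total (size p) (size q)) => le_pq; apply/orP; [left|right].
  by rewrite -(prepend_eq le_pq eqpq).
by rewrite -(prepend_eq le_pq (esym eqpq)).
Qed.

Lemma perp_prepend p q xi eta : perp p q -> prepend p xi <> prepend q eta.
Proof.
by move=> /andP[/negPf pq /negPf qp] /prepend_prefixes; rewrite pq qp.
Qed.

Lemma perpI p q : (forall xi eta, prepend p xi <> prepend q eta) -> perp p q.
Proof.
move=> neq; apply/andP; split; apply/negP => /prefixP[w eqw].
  by apply: (neq (prepend w (fun=> false)) (fun=> false)); rewrite -prepend_cat -eqw.
by apply: (neq (fun=> false) (prepend w (fun=> false))); rewrite -prepend_cat -eqw.
Qed.

Lemma perp_cat p q v w : perp p q -> perp (p ++ v) (q ++ w).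
Proof.
move=> pq; apply: perpI => xi eta; rewrite !prepend_cat.
exact: perp_prepend.
Qed.

Lemma perp_catl p q v : perp p q -> perp (p ++ v) q.
Proof. by move/(@perp_cat _ _ v [::]); rewrite cats0. Qed.

Lemma perp_catr p q w : perp p q -> perp p (q ++ w).
Proof. by move/(@perp_cat _ _ [::] w); rewrite cats0. Qed.

Lemma perp_cat2l p v w : perp (p ++ v) (p ++ w) = perp v w.
Proof. by rewrite /perp !prefix_catr // !eqxx. Qed.

Lemma perp_size p q : size p = size q -> perp p q = (p != q).
Proof.
by move=> eqs; rewrite /perp !prefixE eqs -{2}eqs !take_size eq_sym andbb.
Qed.

(** Falling back to the identity makes [sw p q] an element of V for all words [p] and [q]. *)
Definition swapf p q (xi : cantor_space) : cantor_space :=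
  if perp p q then
    if starts p xi then prepend q (cdrop (size p) xi)
    else if starts q xi then prepend p (cdrop (size q) xi) else xi
  else xi.

Lemma swapf_l p q xi : perp p q -> swapf p q (prepend p xi) = prepend q xi.
Proof.
move=> pq; rewrite /swapf pq ifT; first by rewrite cdrop_prepend.
by apply/startsP; exists xi.
Qed.

Lemma swapf_r p q xi : perp p q -> swapf p q (prepend q xi) = prepend p xi.
Proof.
move=> pq; rewrite /swapf pq ifF; last first.
  by apply/startsP => -[eta] /esym; apply: perp_prepend.
by rewrite ifT ?cdrop_prepend //; apply/startsP; exists xi.
Qed.

Lemma swapf_out p q xi : ~~ starts p xi -> ~~ starts q xi -> swapf p q xi = xi.
Proof. by rewrite /swapf => /negPf -> /negPf ->; case: perp. Qed.

Lemma perp_starts p q xi : perp p q -> ~~ starts p (prepend q xi).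
Proof. by move=> pq; apply/startsP => -[eta /esym]; apply: perp_prepend. Qed.

Lemma swapf_perp p q w xi :
  perp p w -> perp q w -> swapf p q (prepend w xi) = prepend w xi.
Proof. by move=> pw qw; rewrite swapf_out // perp_starts. Qed.

Variant swapf_spec p q xi : Prop :=
| SwapfL eta of xi = prepend p eta
| SwapfR eta of xi = prepend q eta
| SwapfOut of ~~ starts p xi & ~~ starts q xi.

Lemma swapf_case p q xi : swapf_spec p q xi.
Proof.
have [/startsP[eta ->]|np] := boolP (starts p xi); first exact: SwapfL.
have [/startsP[eta ->]|nq] := boolP (starts q xi); first exact: SwapfR.
exact: SwapfOut.
Qed.

Lemma swapfK p q : involutive (swapf p q).
Proof.
have [pq|npq] := boolP (perp p q); last by move=> xi; rewrite /swapf (negPf npq).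
move=> xi; have [eta ->|eta ->|np nq] := swapf_case p q xi.
- by rewrite swapf_l // swapf_r.
- by rewrite swapf_r // swapf_l.
- by rewrite !swapf_out.
Qed.

Lemma perp_or_prefix p u : size p <= size u -> perp p u || prefix p u.
Proof.
move=> le; rewrite /perp; case: (boolP (prefix p u)) => //= np; rewrite orbF.
apply/negP => /prefixP[w eqp]; move: le np; rewrite eqp size_cat.
case: w {eqp} => [|s w]; last by rewrite /=; lia.
by rewrite cats0 prefix_refl.
Qed.

Lemma swapf_uniform p q : uniform_fun (swapf p q).
Proof.
have [pq|npq] := boolP (perp p q); last first.
  by exists 0 => u _; exists u => xi; rewrite /swapf (negPf npq).
exists (maxn (size p) (size q)) => u size_u.
have [lep leq] : size p <= size u /\ size q <= size u.
  by rewrite size_u leq_maxl leq_maxr.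
case/orP: (perp_or_prefix lep) => [pu|/prefixP[w ->]]; last first.
  by exists (q ++ w) => xi; rewrite !prepend_cat swapf_l.
case/orP: (perp_or_prefix leq) => [qu|/prefixP[w ->]]; last first.
  by exists (p ++ w) => xi; rewrite !prepend_cat swapf_r.
by exists u => xi; rewrite swapf_perp.
Qed.

Definition sw p q : thompsonV := involV (@swapfK p q) (swapf_uniform p q).

Lemma sw_sym p q : sw p q = sw q p.
Proof.
apply: thompsonVP => xi /=.
have [pq|npq] := boolP (perp p q); last first.
  by rewrite /swapf [perp q p]perp_sym (negPf npq).
have qp : perp q p by rewrite perp_sym.
have [eta ->|eta ->|np nq] := swapf_case p q xi.
- by rewrite swapf_l // swapf_r.
- by rewrite swapf_r // swapf_l.
- by rewrite !swapf_out.
Qed.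

Lemma image_perp (g : thompsonV) p q p' q' :
  (forall xi, g (prepend p xi) = prepend p' xi) ->
  (forall xi, g (prepend q xi) = prepend q' xi) -> perp p q -> perp p' q'.
Proof.
move=> gp gq pq; apply: perpI => xi eta; rewrite -gp -gq.
by move/(can_inj (homeo_funK g)); apply: perp_prepend.
Qed.

Lemma conj_sw (g : thompsonV) p q p' q' : perp p q ->
  (forall xi, g (prepend p xi) = prepend p' xi) ->
  (forall xi, g (prepend q xi) = prepend q' xi) ->
  sw p' q' = (g * sw p q * g^-1)%g.
Proof.
move=> pq gp gq; have pq' := image_perp gp gq pq.
suff eqg : (sw p' q' * g = g * sw p q)%g by rewrite -eqg mulgK.
apply: thompsonVP => xi.
rewrite [LHS]/= [RHS]/=.
have [eta ->|eta ->|np nq] := swapf_case p q xi.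
- by rewrite swapf_l // gp gq swapf_l.
- by rewrite swapf_r // gp gq swapf_r.
- rewrite [in RHS]swapf_out // swapf_out //.
  + apply: contra np => /startsP[eta]; rewrite -gp => /(can_inj (homeo_funK g)) ->.
    by apply/startsP; exists eta.
  + apply: contra nq => /startsP[eta]; rewrite -gq => /(can_inj (homeo_funK g)) ->.
    by apply/startsP; exists eta.
Qed.

(** Reduces generation to swaps of arbitrarily deep cones. *)
Lemma sw_children p q : perp p q ->
  sw p q = (sw (rcons p false) (rcons q false) * sw (rcons p true) (rcons q true))%g.
Proof.
move=> pq; apply: thompsonVP => xi /=; rewrite -!cats1.
have P s t : perp (p ++ [:: s]) (q ++ [:: t]) by apply: perp_cat.
have P' s t : perp (q ++ [:: s]) (p ++ [:: t]) by rewrite perp_sym.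
have Q r : perp (r ++ [:: true]) (r ++ [:: false]) by rewrite perp_cat2l.
have Q' r : perp (r ++ [:: false]) (r ++ [:: true]) by rewrite perp_cat2l.
have [eta ->|eta ->|np nq] := swapf_case p q xi.
- have [s [eta' ->]] := cantor_case eta; rewrite swapf_l // -!prepend_cat.
  by case: s; [rewrite swapf_l // swapf_perp | rewrite swapf_perp // swapf_l].
- have [s [eta' ->]] := cantor_case eta; rewrite swapf_r // -!prepend_cat.
  by case: s; [rewrite swapf_r // swapf_perp | rewrite swapf_perp // swapf_r].
- have N r s : ~~ starts r xi -> ~~ starts (r ++ [:: s]) xi.
    apply: contra => /startsP[eta ->]; apply/startsP; rewrite prepend_cat.
    by exists (prepend [:: s] eta).
  by rewrite !swapf_out // N.
Qed.

(** * The generating sets *)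

Definition cflip (xi : cantor_space) : cantor_space :=
  prepend [:: ~~ xi 0] (ctail xi).

(* The Grigorchuk action on infinite words, truncated so that [x] acts trivially
   on the cone of [1^n]; on the cone of [1^(n-1)0] it may still flip the next
   letter. *)
Fixpoint cact n (x : klein) (xi : cantor_space) : cantor_space :=
  if n is n'.+1 then
    if xi 0 then prepend [:: true] (cact n' (krot x) (ctail xi))
    else prepend [:: false] (if x.1 then cflip (ctail xi) else ctail xi)
  else xi.

Fixpoint crun n (xs : seq klein) (xi : cantor_space) : cantor_space :=
  if xs is x :: xs' then
    if xs' is _ :: _ then crun n xs' (cflip (cact n x xi)) else cact n x xi
  else xi.

Lemma cflip_prepend s v xi : cflip (prepend (s :: v) xi) = prepend (~~ s :: v) xi.
Proof. by rewrite /cflip ctail_prepend -prepend_cons. Qed.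

Lemma cflipK : involutive cflip.
Proof.
move=> xi; have [s [eta ->]] := cantor_case xi.
by rewrite !cflip_prepend negbK.
Qed.

Lemma cact_cons n x s xi : cact n.+1 x (prepend [:: s] xi) =
  prepend [:: s] (if s then cact n (krot x) xi else if x.1 then cflip xi else xi).
Proof. by rewrite /= ctail_prepend prepend_nil; case: s. Qed.

Lemma cactM n x y xi : cact n (kmul x y) xi = cact n y (cact n x xi).
Proof.
elim: n x y xi => // n IHn x y xi; have [s [eta ->]] := cantor_case xi.
rewrite !cact_cons; congr prepend; case: s; first by rewrite krotM IHn.
by rewrite /=; case: x.1 => /=; case: y.1 => //=; rewrite cflipK.
Qed.

Lemma cact1 n xi : cact n kone xi = xi.
Proof.
elim: n xi => // n IHn xi; have [s [eta ->]] := cantor_case xi.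
by rewrite cact_cons /= (IHn eta); case: s.
Qed.

Lemma cactK n x : involutive (cact n x).
Proof.
move=> xi; rewrite -cactM -[RHS](cact1 n).
by congr (cact n _ xi); case: x => [[] []].
Qed.

Lemma cflip_uniform : uniform_fun cflip.
Proof.
exists 1 => -[|s [|]] //= _; exists [:: ~~ s] => xi.
exact: cflip_prepend.
Qed.

Lemma cact_uniform n x : uniform_fun (cact n x).
Proof.
exists n.+1; elim: n x => [|n IHn] x [|s v] // [size_v]; first by exists (s :: v).
have [u' xu] := IHn (krot x) v size_v.
case: s; [exists (true :: u') | exists (false :: if x.1 then wflip v else v)] => xi.
  by rewrite prepend_cons cact_cons xu -prepend_cons.
rewrite prepend_cons cact_cons [in RHS]prepend_cons; congr prepend.
by case: x.1 => //; case: v size_v {xu} => //= t v _; rewrite cflip_prepend.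
Qed.

Lemma crun_cons n x y xs xi :
  crun n (x :: y :: xs) xi = crun n (y :: xs) (cflip (cact n x xi)).
Proof. by []. Qed.

Lemma crun_head n x xs xi : crun n (x :: xs) xi = crun n (kone :: xs) (cact n x xi).
Proof. by case: xs => [|y xs] /=; rewrite cact1. Qed.

(** The wreath recursion on infinite words. A list of length [l] contains [l - 1] letters [a], and
    each of them flips the first letter. *)
Lemma crun_sec n s xs xi : crun n.+1 xs (prepend [:: s] xi) =
  prepend [:: s (+) odd (size xs).-1] (crun n (sec s xs) xi).
Proof.
elim: xs s xi => [|x [|y xs] IHxs] s xi.
- by rewrite addbF; case: s => /=; rewrite cact1.
- have -> : crun n.+1 [:: x] (prepend [:: s] xi) =
      cact n.+1 x (prepend [:: s] xi) by [].
  rewrite addbF cact_cons; congr prepend; case: s => /=; first by rewrite kmul1.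
  by case: x.1 => /=; rewrite !cact1.
- rewrite crun_cons cact_cons cflip_prepend IHxs.
  rewrite (_ : ~~ s (+) odd (size (y :: xs)).-1 =
    s (+) odd (size [:: x, y & xs]).-1); last by rewrite /= addNb addbN.
  congr prepend; case: s.
    rewrite -[sec true _]/(kmul (krot x) (head kone (sec false (y :: xs))) ::
      behead (sec false (y :: xs))).
    by rewrite crun_head cactM -crun_head -sec_cons.
  rewrite -[sec false (x :: _)]/(if x.1 then kone :: sec true (y :: xs)
     else sec true (y :: xs)).
  case: x.1 => //.
  by rewrite [sec true (y :: xs)]sec_cons crun_cons cact1.
Qed.

(** The image of the prefix [u], read off from the parity of the number of letters [a] in each
    section along [u]. *)
Fixpoint wfin (xs : seq klein) (u : seq bool) : seq bool :=
  if u is s :: u' then (s (+) odd (size xs).-1) :: wfin (sec s xs) u' else [::].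

Lemma crun_secs k j xs u xi : size u = k ->
  crun (k + j) xs (prepend u xi) = prepend (wfin xs u) (crun j (secs u xs) xi).
Proof.
move=> <- {k}; elim: u xs => [|s u IHu] xs; first by rewrite /= !prepend_nil.
by rewrite prepend_cons crun_sec IHu -prepend_cons.
Qed.

Lemma size_wfin xs u : size (wfin xs u) = size u.
Proof. by elim: u xs => //= s u IHu xs; rewrite IHu. Qed.

Lemma cact_prefix n x v xi : size v = n ->
  exists eta, cact n x (prepend v xi) = prepend (wact x v) eta.
Proof.
elim: n x v => [|n IHn] x [|s v] //=; first by move=> _; exists xi.
case=> size_v; rewrite ctail_prepend; case: s => /=.
  by have [eta ->] := IHn (krot x) v size_v; exists eta; rewrite -prepend_cons.
case: x.1; last by exists xi; rewrite -prepend_cons.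
case: v size_v => [_|t v _]; first by exists (cflip xi); rewrite prepend_nil.
by exists xi; rewrite cflip_prepend -prepend_cons.
Qed.

(** The flip falls on the letter after the first [false]; this letter lies outside [v] only for
    [v = 1...10]. *)
Lemma cact_inner n x v xi : size v = n -> v != rcons (nseq n.-1 true) false ->
  cact n x (prepend v xi) = prepend (wact x v) xi.
Proof.
elim: n x v => [|n IHn] x [|s v] //= [size_v] v_end.
rewrite ctail_prepend; case: s v_end => /= v_end.
  rewrite [in RHS]prepend_cons; congr prepend; case: n => [|n] in IHn size_v v_end *.
    by rewrite (size0nil size_v).
  by apply: IHn => //; apply: contra v_end => /eqP -> /=.
rewrite [in RHS]prepend_cons; congr prepend; case: x.1 => //.
by case: v size_v v_end => [<-|t v _ _] //; rewrite cflip_prepend.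
Qed.

Definition wroot m := nseq m true.

(* The leaves of the partition [0, 10, 11], which is not invariant under
   flipping the first letter. *)
Definition leaf (a : option bool) : seq bool :=
  if a is Some s then [:: true; s] else [:: false].

(* A leaf below the root ([false]) or below its neighbour ([true]). *)
Definition cell := (bool * option bool)%type.
Definition cellword m (c : cell) : seq bool :=
  (if c.1 then wflip (wroot m) else wroot m) ++ leaf c.2.

(** [None] is the letter [a]. *)
Definition letter := option (klein + cell * cell)%type.

Definition lact m (l : letter) : cantor_space -> cantor_space :=
  match l with
  | None => cflip
  | Some (inl x) => cact m x
  | Some (inr (c, d)) => swapf (cellword m c) (cellword m d)
  end.

Definition wrun m (w : seq letter) (xi : cantor_space) :=
  foldl (fun xi l => lact m l xi) xi w.

(* Each entry [x] of a block stands for [x a]. A swap is replaced by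
   [1 a 1 a], which is trivial but visits the root exactly from the two
   vertices whose cones the swap may move. *)
Definition lblock (l : letter) : seq klein :=
  match l with
  | None => [:: kone]
  | Some (inl x) => [:: x; kone]
  | Some (inr _) => [:: kone; kone]
  end.

Definition hword (w : seq letter) : seq klein := flatten (map lblock w) ++ [:: kone].

Lemma hword_cons l w : hword (l :: w) = lblock l ++ hword w.
Proof. by rewrite /hword /= catA. Qed.

Lemma hword_neq0 w : hword w = head kone (hword w) :: behead (hword w).
Proof. by rewrite /hword; case: flatten. Qed.

Lemma wt_hword w : wt (hword w) <= 10 * size w + 4.
Proof.
elim: w => [|l w IHw]; first by rewrite wt_cons wt_nil.
rewrite hword_cons wt_cat; have : wt (lblock l) <= 10.
  by case: l => [[[[] []]|?]|]; rewrite /= !wt_cons wt_nil.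
by rewrite /=; lia.
Qed.

Lemma wflip_root_eq m v : (wflip v == wroot m) = (v == wflip (wroot m)).
Proof. by apply/eqP/eqP => [<-|->]; rewrite wflipK. Qed.

Lemma visit_hword_cons l w v : visit (hword (l :: w)) v =
  (v == wroot (size v)) || match l with
  | None => visit (hword w) (wflip v)
  | Some (inl x) => (wflip (wact x v) == wroot (size v)) || visit (hword w) (wact x v)
  | Some (inr _) => (wflip v == wroot (size v)) || visit (hword w) v
  end.
Proof.
rewrite hword_cons hword_neq0.
by case: l => [[x|c]|] /=; rewrite ?wact1 ?wflipK ?size_wflip ?size_wact.
Qed.

Lemma crun_hword_cons m l w xi : crun m (hword (l :: w)) xi =
  crun m (hword w) (if l is Some (inr _) then xi else lact m l xi).
Proof.
rewrite hword_cons hword_neq0.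
by case: l => [[x|c]|] /=; rewrite ?cact1 ?cflipK.
Qed.

Lemma cellword_notin m c v xi : size v = m -> v != wroot m -> v != wflip (wroot m) ->
  ~~ starts (cellword m c) (prepend v xi).
Proof.
move=> size_v v1 v2; apply: perp_starts; apply: perp_catl.
case: c => -[] a; rewrite perp_size ?size_wflip ?size_nseq ?size_v //= eq_sym //.
Qed.

(* If the Grigorchuk trajectory of [v] never meets the root or its neighbour,
   then the swaps in [w] do not act on it. *)
Lemma wrun_crun m w v xi : 0 < m -> size v = m -> ~~ visit (hword w) v ->
  wrun m w (prepend v xi) = crun m (hword w) (prepend v xi).
Proof.
move=> m_gt0; elim: w v xi => [|l w IHw] v xi size_v.
  by move=> _; rewrite /= cact1.
rewrite visit_hword_cons negb_or crun_hword_cons size_v /= => /andP[v_root].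
case: l => [[x|[c d]]|] /=.
- rewrite negb_or => /andP[_]; have [eta ->] := cact_prefix x xi size_v.
  by apply: IHw; rewrite size_wact.
- rewrite negb_or wflip_root_eq => /andP[v_root' vis].
  by rewrite swapf_out ?cellword_notin // IHw.
- case: v size_v {v_root} => [|s v] size_v; first by rewrite -size_v in m_gt0.
  by rewrite cflip_prepend; apply: IHw.
Qed.

Lemma wpos_wflip_root m : wpos (wflip (wroot m)) <= 1.
Proof. by case: m => //= m; rewrite wpos_root. Qed.

(** Each letter moves at most one step along the path. The extra one arises because blocks of length
    two also test the neighbour of the root. *)
Lemma wpos_visit w v : visit (hword w) v -> wpos v <= (size w).+1.
Proof.
elim: w v => [|l w IHw] v.
  by rewrite /= orbF => /eqP ->; rewrite wpos_root.
rewrite visit_hword_cons => /orP[/eqP ->|]; first by rewrite wpos_root.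
have lip_flip u : wpos u <= (wpos (wflip u)).+1 by rewrite -{1}[u]wflipK wpos_flip.
have lip_act x u : wpos u <= (wpos (wact x u)).+1.
  by rewrite -{1}[u](wactK x) wpos_wact.
case: l => [[x|c]|] /=.
- case/orP=> [|/IHw]; last by have := lip_act x v; lia.
  rewrite wflip_root_eq => /eqP eqx; have := lip_act x v.
  by have := wpos_wflip_root (size v); rewrite -eqx; lia.
- case/orP=> [|/IHw]; last by lia.
  by rewrite wflip_root_eq => /eqP {1}->; have := wpos_wflip_root (size v); lia.
- by move/IHw; have := lip_flip v; lia.
Qed.

Definition spot := (seq bool * option bool)%type.
Definition spotword (p : spot) : seq bool := p.1 ++ leaf p.2.
Definition cellspot m (c : cell) : spot :=
  (if c.1 then wflip (wroot m) else wroot m, c.2).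

Definition lstep m (p : spot) (l : letter) : spot :=
  match l with
  | None => (wflip p.1, p.2)
  | Some (inl x) => (wact x p.1, p.2)
  | Some (inr (c, d)) =>
    if p == cellspot m c then cellspot m d
    else if p == cellspot m d then cellspot m c else p
  end.

Lemma size_cellspot m c : size (cellspot m c).1 = m.
Proof. by case: c => -[] a; rewrite /= ?size_wflip size_nseq. Qed.

Lemma size_lstep m p l : size p.1 = m -> size (lstep m p l).1 = m.
Proof.
case: l => [[x|[c d]]|] /= size_p; rewrite ?size_wact ?size_wflip //.
by case: ifP => _; [|case: ifP => _ //]; rewrite size_cellspot.
Qed.

Lemma wpos_lstep m p l : wpos (lstep m p l).1 <= (wpos p.1).+1.
Proof.
have small c : wpos (cellspot m c).1 <= 1.
  by case: c => -[] a /=; rewrite ?wpos_wflip_root // wpos_root.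
case: l => [[x|[c d]]|] /=; rewrite ?wpos_wact ?wpos_flip //.
case: ifP => _; first by have := small d; lia.
by case: ifP => _; [have := small c; lia | lia].
Qed.

Lemma perp_spotword p q : size p.1 = size q.1 -> perp (spotword p) (spotword q) = (p != q).
Proof.
case: p q => [u a] [v b] /= eqs; rewrite /spotword /perp !prefix_catr //= [v == u]eq_sym.
rewrite xpair_eqE; case: (u == v) => //=.
by case: a b => [[]|] [[]|].
Qed.

Lemma lact_spot m p l xi : 0 < m -> size p.1 = m -> (wpos p.1).+1 < 2 ^ m ->
  lact m l (prepend (spotword p) xi) = prepend (spotword (lstep m p l)) xi.
Proof.
case: m => // m _; case: p => v a size_v posv.
case: l => [[x|[c d]]|].
- rewrite /lact /lstep /spotword !prepend_cat cact_inner //.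
  (* The excluded word [1...10] sits at the last position of the path. *)
  by apply: contraTneq posv => /= ->; rewrite wpos_end ltnn.
- rewrite /lact /lstep -[cellword _ c]/(spotword (cellspot m.+1 c)).
  rewrite -[cellword _ d]/(spotword (cellspot m.+1 d)).
  have perp_cell e : perp (spotword (cellspot m.+1 e)) (spotword (v, a)) =
      ((v, a) != cellspot m.+1 e).
    by rewrite perp_spotword ?size_cellspot // eq_sym.
  have [cd|cd] := boolP (cellspot m.+1 c == cellspot m.+1 d).
    rewrite /swapf perp_spotword ?size_cellspot // cd (eqP cd).
    by case: ((v, a) =P cellspot m.+1 d) => [->|].
  have pcd : perp (spotword (cellspot m.+1 c)) (spotword (cellspot m.+1 d)).
    by rewrite perp_spotword ?size_cellspot.
  case: ifP => [/eqP ->|/negbT pc]; first by rewrite swapf_l.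
  case: ifP => [/eqP ->|/negbT pd]; first by rewrite swapf_r.
  by rewrite swapf_perp ?perp_cell.
- by case: v size_v {posv} => // s v _; rewrite /= cflip_prepend.
Qed.

(* Far from the end [1...10] of the path the generators permute the cones
   [v ++ leaf a]. *)
Lemma wrun_spot m p w xi : 0 < m -> size p.1 = m -> wpos p.1 + size w < 2 ^ m ->
  wrun m w (prepend (spotword p) xi) = prepend (spotword (foldl (lstep m) p w)) xi.
Proof.
move=> m_gt0; elim: w p => [|l w IHw] p size_p //= posp.
rewrite lact_spot //; last by move: posp; rewrite /=; lia.
apply: IHw; first exact: size_lstep.
by have := wpos_lstep m p l; lia.
Qed.

Lemma spot_case xi m : exists p eta, size p.1 = m /\ xi = prepend (spotword p) eta.
Proof.
rewrite (prepend_prefix xi m); move: (fun n => xi (m + n)) => eta.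
have size_v := size_mkseq xi m.
have [s [z ->]] := cantor_case eta; case: s; last first.
  by exists (mkseq xi m, None), z; rewrite /spotword prepend_cat.
have [s [z' ->]] := cantor_case z; exists (mkseq xi m, Some s), z'.
by rewrite /spotword prepend_cat (prepend_cons true [:: s]).
Qed.

(** * Counting the ball *)

Lemma lactK m l : involutive (lact m l).
Proof. by case: l => [[x|[c d]]|]; [apply: cactK|apply: swapfK|apply: cflipK]. Qed.

Lemma lact_uniform m l : uniform_fun (lact m l).
Proof.
by case: l => [[x|[c d]]|]; [apply: cact_uniform|apply: swapf_uniform|apply: cflip_uniform].
Qed.

Definition lactV m l : thompsonV := involV (lactK m l) (lact_uniform m l).

Definition gens m : {fset thompsonV} := [fset lactV m l | l in {: letter}]%fset.

Lemma mem_gens m l : lactV m l \in gens m.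
Proof. exact: in_imfset. Qed.

Lemma word_over_gens m w : word_over (gens m) w ->
  exists2 ls, size ls = size w & w = map (lactV m) ls.
Proof.
elim: w => [_|g w IHw /=]; first by exists [::].
case/andP => Sg /IHw[ls <- ->].
suff [l ->]: exists l, g = lactV m l by exists (l :: ls).
case/orP: Sg => /imfsetP[l _]; first by exists l.
by move=> eqg; exists l; rewrite -[g]invgK eqg involV_inv.
Qed.

(** The last factor of a product acts first, whereas [wrun] reads from left to right; hence the
    reversal. *)
Lemma prod_gens m ls xi :
  (\prod_(g <- map (lactV m) ls) g)%g xi = wrun m (rev ls) xi.
Proof.
elim: ls xi => [|l ls IHls] xi; first by rewrite big_nil.
by rewrite /= big_cons rev_cons /wrun foldl_rcons -/(wrun _ _ _) -IHls.
Qed.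

(** Encodes the lists of length at most [n] in a finite type of known cardinality. *)
Definition pad (X : Type) n (s : seq X) : n.-tuple (option X) :=
  [tuple nth None (map Some s) i | i < n].

Lemma padK (X : Type) n (s : seq X) : size s <= n -> pmap id (pad n s) = s.
Proof.
move=> le_sn; have -> : tval (pad n s) = map Some s ++ nseq (n - size s) None.
  apply: (@eq_from_nth _ None) => [|i].
    by rewrite size_tuple size_cat size_map size_nseq subnKC.
  rewrite size_tuple => lt_in; rewrite -[i]/(val (Ordinal lt_in)) -tnth_nth.
  rewrite tnth_mktuple nth_cat size_map /=; case: ltnP => // le_si.
  by rewrite nth_default ?size_map // nth_nseq if_same.
rewrite pmap_cat [X in _ ++ X](_ : _ = [::]) ?cats0 ?map_pK //.
by elim: (n - size s).
Qed.

Lemma perm_words n : perm_eq (map val (enum {: n.-tuple bool})) (words n).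
Proof.
apply: uniq_perm; rewrite ?uniq_words ?(map_inj_uniq val_inj) ?enum_uniq // => v.
rewrite mem_words; apply/mapP/eqP => [[t _ ->]|size_v]; first exact: size_tuple.
by exists (Tuple (introT eqP size_v)); rewrite ?mem_enum.
Qed.

Lemma sum_tuple n (F : seq bool -> nat) :
  \sum_(u : n.-tuple bool) F u = \sum_(u <- words n) F u.
Proof. by rewrite -(perm_big _ (perm_words n)) big_map big_enum. Qed.

Lemma filter_allpairs_dep (X Y : eqType) (F : X -> seq Y) (s : seq X) u :
  uniq s -> [seq p.2 | p <- [seq (v, x) | v <- s, x <- F v] & p.1 == u] =
            if u \in s then F u else [::].
Proof.
elim: s => //= v s IHs /andP[vs us].
rewrite filter_cat map_cat IHs // filter_map -map_comp inE.
rewrite (@eq_filter _ _ (fun=> v == u)) // [v == u]eq_sym.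
have [->|_] := eqVneq u v; last by rewrite filter_pred0.
by rewrite (negPf vs) cats0 filter_predT map_id.
Qed.

Section Code.
Variable k : nat.

(** All sections in one list, each entry tagged with its vertex: only the total length of the
    sections is bounded, not each length usefully. *)
Definition secdata (xs : seq klein) : seq (k.-tuple bool * klein) :=
  [seq (u, x) | u <- enum {: k.-tuple bool}, x <- secs (val u) xs].

Lemma secdata_inj xs ys : secdata xs = secdata ys ->
  forall u : k.-tuple bool, secs u xs = secs u ys.
Proof.
move=> eqd u; have dec zs : [seq p.2 | p <- secdata zs & p.1 == u] = secs u zs.
  by rewrite filter_allpairs_dep ?enum_uniq // mem_enum.
by rewrite -!dec eqd.
Qed.

Lemma size_secdata xs : size (secdata xs) = \sum_(u <- words k) size (secs u xs).
Proof. by rewrite size_allpairs_dep sumnE big_map big_enum -sum_tuple. Qed.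

Definition findata (xs : seq klein) : {ffun k.-tuple bool -> k.-tuple bool} :=
  [ffun u : k.-tuple bool => insubd u (wfin xs u)].

Lemma findata_inj xs ys : findata xs = findata ys ->
  forall u : k.-tuple bool, wfin xs u = wfin ys u.
Proof.
move=> eqd u; have := congr1 (fun d : {ffun _ -> _} => val (d u)) eqd.
by rewrite !ffunE !val_insubd !size_wfin size_tuple eqxx.
Qed.

End Code.

Section SpotCode.
Variable m : nat.
Definition tspot := (m.-tuple bool * option bool)%type.

(** Pairs of a start and its end. Recording the starts lets the list also determine which vertices
    are visited. *)
Definition spotdata (w : seq letter) : seq (tspot * tspot) :=
  [seq let p := foldl (lstep m) (val va.1, va.2) w in
       (va : tspot, (insubd va.1 p.1, p.2)) |
   va <- enum {: tspot} & visit (hword w) (val va.1)].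

Lemma size_foldl_lstep p w : size p.1 = m -> size (foldl (lstep m) p w).1 = m.
Proof. by elim: w p => //= l w IHw p size_p; apply/IHw/size_lstep. Qed.

Lemma spotdata_inj w w' : spotdata w = spotdata w' -> forall va : tspot,
  visit (hword w) va.1 = visit (hword w') va.1 /\
  (visit (hword w) va.1 ->
    foldl (lstep m) (val va.1, va.2) w = foldl (lstep m) (val va.1, va.2) w').
Proof.
have sub z z' : spotdata z = spotdata z' -> forall va : tspot,
    visit (hword z) va.1 -> visit (hword z') va.1 /\
    foldl (lstep m) (val va.1, va.2) z = foldl (lstep m) (val va.1, va.2) z'.
  move=> eqd va vis; pose f := fun z (va : tspot) =>
    let p := foldl (lstep m) (val va.1, va.2) z in
    (va, ((insubd va.1 p.1, p.2) : tspot)).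
  have : f z va \in spotdata z by rewrite map_f // mem_filter vis mem_enum.
  rewrite eqd => /mapP[vb]; rewrite mem_filter => /andP[vis' _] /= [eqv eqi eq2].
  subst vb; split=> //; move/(congr1 val): eqi.
  rewrite !val_insubd !size_foldl_lstep ?size_tuple // eqxx => eq1.
  by apply: injective_projections.
move=> eqd va; split; last by move=> /(sub _ _ eqd)[].
by apply/idP/idP => [/(sub _ _ eqd)[]//|/(sub _ _ (esym eqd))[]].
Qed.

Lemma size_spotdata w : size (spotdata w) = 3 * count (visit (hword w)) (words m).
Proof.
rewrite size_map size_filter -sum1_count big_enum_cond /=.
transitivity (\sum_(v : m.-tuple bool | visit (hword w) v) \sum_(a : option bool) 1).
  by rewrite pair_big; apply: eq_bigl => va; rewrite andbT.
under eq_bigr => v _ do rewrite sum1_card card_option card_bool.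
rewrite sum_nat_const mulnC; congr (_ * _).
by rewrite -(permP (perm_words m)) count_map -sum1_count big_enum_cond /= sum1_card.
Qed.
End SpotCode.

(** Each element is sent to the code of one chosen word for it; this is injective because [dec]
    factors through [code]. *)
Lemma card_code (G : choiceType) (T : finType) (W : Type) (A : set G)
    (dec : W -> G) (code : W -> T) (P : W -> Prop) :
  finite_set A -> (forall g, A g -> exists2 w, P w & g = dec w) ->
  (forall w w', P w -> P w' -> code w = code w' -> dec w = dec w') ->
  #|` fset_set A| <= #|T|.
Proof.
move=> finA Adec codeP.
have /choice[f fP] : forall g : fset_set A, exists t : T,
    exists2 w, P w & val g = dec w /\ t = code w.
  move=> g; have : A (val g) by have := valP g; rewrite in_fset_set // inE.
  by case/Adec => w Pw eqg; exists (code w), w.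
rewrite cardfE; apply: (@leq_card _ _ f) => g h eqf; apply: val_inj.
have [w Pw [-> fg]] := fP g; have [w' Pw' [-> fh]] := fP h.
by apply: codeP => //; rewrite -fg -fh.
Qed.

(** The bound of [wt_secs] at level [k] for words of length [2 ^ (m - 2)], [m = 2k], whose weight is
    bounded by [wt_hword]. *)
Definition budget k := (5 ^ k * (10 * 2 ^ (k + k - 2) + 4) + 7 * 12 ^ k) %/ 6 ^ k.

Lemma sum_secs_budget k w : size w <= 2 ^ (k + k - 2) ->
  \sum_(u <- words k) wt (secs u (hword w)) <= budget k.
Proof.
move=> le_w; rewrite leq_divRL ?expn_gt0 // mulnC.
apply: leq_trans (leq_addr (7 * 5 ^ k) _) _; apply: leq_trans (wt_secs _ _) _.
rewrite leq_add2r leq_mul2l; apply/orP; right; apply: leq_trans (wt_hword w) _.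
by rewrite leq_add2r leq_mul2l.
Qed.

(* An element is determined by its sections at level [k] and by its action on
   the cones below the few vertices whose trajectory meets a swap. *)
Lemma growth_gens k : 1 < k -> growth (gens (k + k)) (2 ^ (k + k - 2)) <=
  2 ^ (k * 2 ^ k + budget k * (13 * k + 15)).
Proof.
move=> k_gt1; set m := k + k; set N := 2 ^ _; set B := budget k.
have m_gt0 : 0 < m by rewrite /m; lia.
have N4 : 4 * N = 2 ^ m by rewrite /N -(expnD 2 2); congr (_ ^ _); rewrite /m; lia.
pose code (w : seq letter) :=
  (findata k (hword w), pad B (secdata k (hword w)), pad (3 * B) (spotdata m w)).
pose dec (w : seq letter) : thompsonV := (\prod_(g <- map (lactV m) (rev w)) g)%g.
apply: leq_trans (_ : #|{: {ffun k.-tuple bool -> k.-tuple bool} *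
    B.-tuple (option (k.-tuple bool * klein)) *
    (3 * B).-tuple (option (tspot m * tspot m))}| <= _).
  apply: (@card_code _ _ _ _ dec code (fun w => size w <= N)).
  - exact: finite_word_ball.
  - move=> g [w [/word_over_gens[ls size_ls ->] le_w ->]].
    exists (rev ls); last by rewrite /dec revK.
    by move: le_w; rewrite size_map size_rev.
  move=> w w' le_w le_w' eqc.
  have /findata_inj eqfin := congr1 (fun c => c.1.1) eqc.
  have eqsec := congr1 (fun c => pmap id (tval c.1.2)) eqc.
  have eqspot := congr1 (fun c => pmap id (tval c.2)) eqc.
  have le_secs z : size z <= N -> size (secdata k (hword z)) <= B.
    move=> le_z; rewrite size_secdata; apply: leq_trans (sum_secs_budget le_z).
    by apply: leq_sum => u _; apply: size_wt.
  have le_spots z : size z <= N -> size (spotdata m z) <= 3 * B.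
    move=> le_z; rewrite size_spotdata leq_mul2l /=.
    exact: leq_trans (count_visit_secs _ _ _) (sum_secs_budget le_z).
  move: eqsec eqspot; rewrite /= !padK ?le_secs ?le_spots //.
  move=> /secdata_inj eqsec /spotdata_inj eqspot.
  apply: thompsonVP => xi; rewrite !prod_gens !revK.
  have [[v a] [eta [size_v ->]]] := spot_case xi m.
  have [] := eqspot (Tuple (introT eqP size_v), a); rewrite /= => eqvis eqstep.
  have [vis|nvis] := boolP (visit (hword w) v).
    (* A visiting start has position at most [N + 1], so the run stays at or before [2 * N + 1],
       which is less than [4 * N = 2 ^ m]. *)
    have pos z : size z <= N -> visit (hword z) v -> wpos v + size z < 2 ^ m.
      have N_gt0 : 0 < N by rewrite expn_gt0.
      by move=> le_z /wpos_visit; rewrite -N4; lia.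
    by rewrite !wrun_spot ?pos -?eqvis // eqstep.
  rewrite /spotword prepend_cat !wrun_crun -?eqvis //.
  rewrite (prepend_prefix (prepend v _) k); move: (fun n => _) => zeta.
  set u := mkseq _ _; have size_u : size u = k by rewrite size_mkseq.
  rewrite !crun_secs //; have := eqsec (Tuple (introT eqP size_u)).
  by have := eqfin (Tuple (introT eqP size_u)) => /= -> ->.
rewrite !card_prod card_ffun !card_tuple !card_option !card_prod !card_tuple.
rewrite card_option card_bool -expnM -mulnA expnD leq_mul2l; apply/orP; right.
(* A section entry takes [k + 3] bits, as [4 * 2 ^ k + 1 <= 2 ^ (k + 3)]; each of the [3 * B] pairs
   of spots takes [2 * m + 4] bits, as [9 * 4 ^ m + 1 <= 16 * 4 ^ m]. *)
rewrite (_ : B * (13 * k + 15) = (k + 3) * B + (m + m + 4) * (3 * B)); last first.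
  by rewrite /m; lia.
rewrite expnD (expnM 2 (k + 3)) (expnM 2 (m + m + 4)); apply: leq_mul.
  by case: (B) => // b; rewrite leq_exp2r // expnD; have := expn_gt0 2 k; lia.
case: (3 * B) => // b; rewrite leq_exp2r // !expnD.
have := expn_gt0 2 m; rewrite orTb; move: (2 ^ m) => A A_gt0.
have : 1 <= A * A by rewrite muln_gt0 A_gt0.
by rewrite (_ : 2 ^ 4 = 16) // mulnACA; lia.
Qed.

(** * The ball has subexponential size at the chosen radius *)

Lemma leq_mul_expn2 c : exists2 i, 0 < i & c * i <= 2 ^ i.
Proof.
have lt_c := @ltn_expl 2 c isT; exists (c.+1 + c.+1) => //.
by rewrite expnD expnS; apply: leq_mul; lia.
Qed.

Lemma budget_small j : exists2 k, 1 < k &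
  j * (k * 2 ^ k + budget k * (13 * k + 15)) <= 2 ^ (k + k - 2).
Proof.
(* Since [2 * 5 ^ 5 <= 6 ^ 5], taking [k = 5 * i] gives (5/6)^k <= 2^(-i). With
   [13 * k + 15 <= 80 * i], the terms in [i * j * 2 ^ i * 2 ^ k] have total coefficient
   [5 + 80 * 7 = 565], and [4520 = 8 * 565]. *)
have [i i_gt0 le_i] := leq_mul_expn2 (4520 * j); exists (5 * i); first by lia.
set k := 5 * i; set N := 2 ^ (k + k - 2).
have N4 : 4 * N = 2 ^ k * 2 ^ k.
  by rewrite /N -(expnD 2 2) -expnD; congr (_ ^ _); rewrite /k; lia.
have N_gt0 : 0 < N by rewrite expn_gt0.
have ik : 2 ^ i <= 2 ^ k by rewrite leq_exp2l // /k; lia.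
have le56 : 2 ^ i * 5 ^ k <= 6 ^ k.
  rewrite /k; elim: (i) => [|n IHn]; first by rewrite muln0.
  by rewrite mulnSr 2!(expnD _ _ 5) expnSr mulnACA; apply: leq_mul; last by vm_compute.
have le_budget : 2 ^ i * budget k <= 10 * N + 4 + 7 * (2 ^ i * 2 ^ k).
  rewrite -(@leq_pmul2l (6 ^ k)) ?expn_gt0 //.
  have : budget k * 6 ^ k <= 5 ^ k * (10 * N + 4) + 7 * 12 ^ k by apply: leq_trunc_div.
  rewrite (_ : 12 = 2 * 6) // expnMn.
  move: (2 ^ i) (5 ^ k) (6 ^ k) (2 ^ k) (budget k) le56 => A D E C Y le56 le1.
  have : A * (Y * E) <= A * (D * (10 * N + 4) + 7 * (C * E)) by rewrite leq_mul2l le1 orbT.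
  have : A * D * (10 * N + 4) <= E * (10 * N + 4) by rewrite leq_mul2r le56 orbT.
  lia.
rewrite -(@leq_pmul2l (2 ^ i)) ?expn_gt0 //.
have : 80 * i * j * (2 ^ i * budget k) <=
       80 * i * j * (10 * N + 4 + 7 * (2 ^ i * 2 ^ k)) by rewrite leq_mul2l le_budget orbT.
have : (13 * k + 15) * (j * (2 ^ i * budget k)) <= 80 * i * (j * (2 ^ i * budget k)).
  by rewrite leq_mul2r; apply/orP; right; rewrite /k; lia.
have : 4520 * j * i * 2 ^ k <= 2 ^ k * 2 ^ k.
  by rewrite leq_mul2r; apply/orP; right; apply: leq_trans le_i ik.
rewrite -N4 => le3.
have : 2 ^ i * (4520 * j * i * 2 ^ k) <= 2 ^ i * (4 * N) by rewrite leq_mul2l le3 orbT.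
have : 4520 * j * i * N <= 2 ^ i * N by rewrite leq_mul2r le_i orbT.
have : 4520 * j * i * 1 <= 4520 * j * i * N by rewrite leq_mul2l N_gt0 orbT.
have -> : k * 2 ^ k = 5 * i * 2 ^ k by [].
move: (2 ^ i) (2 ^ k) (budget k) (13 * k + 15) => A C Y z; clear.
lia.
Qed.

(** * Generation by cone swaps *)

Section Spanned.
Variables (G : groupType) (S : {fset G}).
Local Open Scope group_scope.

Definition spanned (g : G) : Prop := exists2 w, word_over S w & g = \prod_(s <- w) s.

Lemma spanned1 : spanned 1.
Proof. by exists [::]; rewrite ?big_nil. Qed.

Lemma spanned_gen s : s \in S -> spanned s.
Proof. by move=> Ss; exists [:: s]; rewrite ?big_seq1 //= Ss. Qed.

Lemma spannedM g h : spanned g -> spanned h -> spanned (g * h).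
Proof.
move=> [v Sv ->] [w Sw ->]; exists (v ++ w); last by rewrite big_cat.
by rewrite /word_over all_cat; apply/andP.
Qed.

Lemma spannedV g : spanned g -> spanned g^-1.
Proof.
move=> [w + ->]; elim: w => [_|s w IHw /= /andP[Ss /IHw Sw]].
  by rewrite big_nil invg1; apply: spanned1.
rewrite big_cons invgM; apply: spannedM => //.
exists [:: s^-1]; last by rewrite big_seq1.
by rewrite /= invgK orbC Ss.
Qed.
End Spanned.

Section Swaps.
Variable H : thompsonV -> Prop.
Hypothesis H1 : H 1%g.
Hypothesis HM : forall g h, H g -> H h -> H (g * h)%g.
Hypothesis HV : forall g, H g -> H g^-1%g.

Lemma sw_nperp p q : ~~ perp p q -> sw p q = 1%g.
Proof. by move=> /negPf npq; apply: thompsonVP => xi /=; rewrite /swapf npq. Qed.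

Lemma sw_conj_closed (g : thompsonV) p q p' q' : H g -> perp p q ->
  (forall xi, g (prepend p xi) = prepend p' xi) ->
  (forall xi, g (prepend q xi) = prepend q' xi) -> H (sw p q) -> H (sw p' q').
Proof. by move=> Hg pq gp gq Hs; rewrite (conj_sw pq gp gq); apply/HM/HV/Hg/HM. Qed.

(** Conjugation by [sw q r] fixes the cone of [p] and carries the cone of [q ++ w] to that of
    [r ++ w]. *)
Lemma sw_trans p q r w : perp p q -> perp p r -> perp q r ->
  H (sw p (q ++ w)) -> H (sw q r) -> H (sw p (r ++ w)).
Proof.
move=> pq pr qr Hs Hqr; apply: (sw_conj_closed Hqr _ _ _ Hs) => [|xi|xi] /=.
- exact: perp_catr.
- by rewrite swapf_perp // perp_sym.
- by rewrite !prepend_cat swapf_l.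
Qed.

Hypothesis Hsw : forall p q, perp p q -> H (sw p q).

Lemma Hsw_all p q : H (sw p q).
Proof. by have [/Hsw//|/sw_nperp->] := boolP (perp p q). Qed.

Definition disjoint_words (L : seq (seq bool)) :=
  {in L &, forall u v, u != v -> perp u v}.
Definition covering (L : seq (seq bool)) :=
  forall xi, exists2 u, u \in L & starts u xi.

Lemma rcons_starts x s xi : starts (rcons x s) xi -> starts x xi.
Proof.
by move=> /startsP[eta ->]; apply/startsP; exists (prepend [:: s] eta); rewrite -prepend_cat cats1.
Qed.

(** Take a longest word of the partition. The word covering its sibling's cone is not longer than
    the sibling, and a proper prefix of the sibling would meet the longest word. *)
Lemma sibling_words L : disjoint_words L -> covering L -> [::] \notin L ->
  exists x, forall s, rcons x s \in L.
Proof.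
move=> disj cov L0.
have [u uL umax] : exists2 u, u \in L & forall v, v \in L -> size v <= size u.
  have [u0 u0L _] := cov (fun=> false).
  have exL : exists n, n \in map size L by exists (size u0); apply: map_f.
  have ubL n : n \in map size L -> n <= \max_(v <- L) size v.
    by move=> /mapP[v vL ->]; apply: leq_bigmax_seq.
  case: (ex_maxnP exL ubL) => _ /mapP[u uL ->] umax.
  by exists u => // v vL; apply/umax/map_f.
case/lastP: u => [|x s] in uL umax *; first by rewrite uL in L0.
exists x => t; have [<-//|] := eqVneq s t; move/eqP=> neq_st.
have [a aL] := cov (prepend (rcons x t) (fun=> false)).
case/startsP=> eta /prepend_prefixes /orP[/prefixP[[|b w] eqa]|/prefixP[w]].
- by rewrite cats0 in eqa; rewrite -eqa.
- by have := umax _ aL; rewrite eqa size_cat !size_rcons /=; lia.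
case/lastP: w => [|w b]; first by rewrite cats0 => ->.
rewrite -rcons_cat => /rcons_inj[eqx _].
have : a != rcons x s.
  by apply/eqP => /(congr1 size); rewrite eqx size_rcons size_cat; lia.
by move/(disj _ _ aL uL); rewrite /perp eqx -cats1 -catA prefix_prefix.
Qed.

Lemma nil_image (g : thompsonV) u :
  (forall xi, g (prepend u xi) = prepend [::] xi) -> u = [::].
Proof.
case: u => // s u gu; have := gu (g (fun=> ~~ s)); rewrite prepend_nil.
move/(can_inj (homeo_funK g)) => /(congr1 (fun xi : cantor_space => xi 0)).
by case: s {gu}.
Qed.

Definition wtransp (p q v : seq bool) :=
  if v == p then q else if v == q then p else v.

Lemma sw_wtransp (L : seq (seq bool)) p q v xi : disjoint_words L -> p \in L -> q \in L -> v \in L ->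
  sw p q (prepend v xi) = prepend (wtransp p q v) xi.
Proof.
move=> disj pL qL vL /=; rewrite /wtransp; have [<-|pq] := eqVneq p q.
  by rewrite /swapf {1}/perp prefix_refl /=; case: eqP => [->|].
have {}pq := disj _ _ pL qL pq.
case: eqP => [->|/eqP vp]; first exact: swapf_l.
case: eqP => [->|/eqP vq]; first exact: swapf_r.
by rewrite swapf_perp // perp_sym disj.
Qed.

Lemma wtransp_in (L : seq (seq bool)) p q v : p \in L -> q \in L -> v \in L -> wtransp p q v \in L.
Proof. by rewrite /wtransp; case: ifP => // _; case: ifP. Qed.

(* Induction on the size of the source partition: after composing with swaps,
   [g] maps two sibling cones to sibling cones in order, and these can be
   merged. *)
Lemma partition_spanned n L f (g : thompsonV) : size L <= n ->
  uniq L -> disjoint_words L -> covering L ->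
  (forall u xi, u \in L -> g (prepend u xi) = prepend (f u) xi) -> H g.
Proof.
elim: n L f g => [|n IHn] L f g.
  by rewrite leqn0 size_eq0 => /eqP -> _ _ cov; have [u] := cov (fun=> false).
move=> szL uL disj cov gf.
have [L0|L0] := boolP ([::] \in L).
  suff f0 : f [::] = [::].
    suff -> : g = 1%g by [].
    by apply: thompsonVP => xi; have := gf _ xi L0; rewrite f0 !prepend_nil.
  apply: (@nil_image g^-1%g) => xi; rewrite -gf //.
  by rewrite prepend_nil; apply: homeo_funK.
set B := map f L.
have Bdisj : disjoint_words B.
  move=> _ _ /mapP[u uL' ->] /mapP[v vL' ->] neqf.
  apply: (@image_perp g u v) => [xi|xi|]; rewrite ?gf // disj //.
  by apply: contraNneq neqf => ->.
have Bcov : covering B.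
  move=> xi; have [u uL' /startsP[eta eqeta]] := cov (homeo_inv g xi).
  exists (f u); first exact: map_f.
  by apply/startsP; exists eta; rewrite -gf // -eqeta homeo_invK.
have B0 : [::] \notin B.
  apply: contra L0 => /mapP[u uL' f0]; rewrite -(_ : u = [::]) //.
  by apply: (@nil_image g) => xi; rewrite gf // f0.
have [x xL] := sibling_words disj cov L0; have [y yB] := sibling_words Bdisj Bcov B0.
have rneq (z : seq bool) : rcons z true != rcons z false.
  by apply/eqP => /rcons_inj[].
(* One swap sends the image of the first child of [x] to the first child of [y], a second one treats
   the other child; as [q] differs from [rcons y false], the second does not undo the first. *)
set p := f (rcons x false); set f1 := fun u => wtransp p (rcons y false) (f u).
set q := f1 (rcons x true); set f2 := fun u => wtransp q (rcons y true) (f1 u).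
have pB : p \in B by apply: map_f.
have f1B u : u \in L -> f1 u \in B by move=> uL'; apply: wtransp_in; rewrite ?map_f.
have qB : q \in B by apply: f1B.
pose g2 := (sw q (rcons y true) * (sw p (rcons y false) * g))%g.
have g2f u xi : u \in L -> g2 (prepend u xi) = prepend (f2 u) xi.
  move=> uL'; rewrite -[g2 _]/(sw q _ (sw p _ (g (prepend u xi)))) gf //.
  by rewrite (sw_wtransp _ Bdisj) ?map_f // (sw_wtransp _ Bdisj) // f1B.
have f10 : f1 (rcons x false) = rcons y false by rewrite /f1 /wtransp eqxx.
have qy : q != rcons y false.
  apply/eqP => eqq; have : g2 (prepend (rcons x true) (fun=> false)) =
      g2 (prepend (rcons x false) (fun=> false)).
    by rewrite !g2f // /f2 f10 -eqq.
  move/(can_inj (homeo_funK g2)); apply: perp_prepend.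
  by rewrite perp_size ?size_rcons.
have f2x s : f2 (rcons x s) = rcons y s.
  case: s; first by rewrite /f2 /wtransp eqxx.
  by rewrite /f2 /wtransp f10 eq_sym (negPf qy) eq_sym (negPf (rneq y)).
have g2x xi : g2 (prepend x xi) = prepend y xi.
  have [s [eta ->]] := cantor_case xi.
  by rewrite -!prepend_cat !cats1 g2f // f2x.
suff : H g2.
  move=> Hg2; rewrite (_ : g = (sw p (rcons y false) * (sw q (rcons y true) * g2))%g).
    by apply: HM; [apply: Hsw_all | apply: HM; [apply: Hsw_all|]].
  by apply: thompsonVP => xi /=; rewrite !swapfK.
(* Merging the two children of [x] leaves one word fewer. *)
pose L' := x :: [seq u <- L | (u != rcons x false) && (u != rcons x true)].
have perpx u : u \in L -> u != rcons x false -> u != rcons x true -> perp u x.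
  move=> uL' u0 u1; apply: perpI => xi eta.
  have [s [eta' ->]] := cantor_case eta; rewrite -prepend_cat cats1.
  by apply: perp_prepend; apply: disj => //; case: s.
have xnL : x \notin L.
  apply/negP => xL'; have : x != rcons x true.
    by apply/eqP => /(congr1 size); rewrite size_rcons; lia.
  by move/(disj _ _ xL' (xL true)); rewrite /perp -cats1 prefix_prefix.
apply: (IHn L' (fun u => if u == x then y else f2 u)).
- have sz0 : count_mem (rcons x false) L = 1 by rewrite count_uniq_mem ?xL.
  have sz1 : count_mem (rcons x true) L = 1 by rewrite count_uniq_mem ?xL.
  rewrite /= size_filter.
  have := count_predC (fun u => (u != rcons x false) && (u != rcons x true)) L.
  rewrite (@eq_count _ (predC _) (predU (pred1 (rcons x false)) (pred1 (rcons x true)))); last first.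
    by move=> u /=; rewrite negb_and !negbK.
  have := count_predUI (pred1 (rcons x false)) (pred1 (rcons x true)) L.
  rewrite (@eq_count _ (predI _ _) pred0) ?count_pred0; last first.
    by move=> u /=; apply/negP => /andP[/eqP ->]; rewrite eq_sym (negPf (rneq x)).
  by rewrite sz0 sz1 addn0 => -> eqL; move: szL; rewrite -eqL addn2.
- by rewrite /= mem_filter (negPf xnL) andbF filter_uniq.
- move=> u v; rewrite !inE !mem_filter.
  case/orP=> [/eqP ->|/andP[/andP[u0 u1] uL']]; case/orP=> [/eqP ->|/andP[/andP[v0 v1] vL']].
  + by rewrite eqxx.
  + by rewrite perp_sym perpx.
  + by rewrite perpx.
  + exact: disj.
- move=> xi; have [u uL' ust] := cov xi.
  have [eq0|u0] := eqVneq u (rcons x false).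
    by exists x; rewrite ?mem_head //; move: ust; rewrite eq0 => /rcons_starts.
  have [eq1|u1] := eqVneq u (rcons x true).
    by exists x; rewrite ?mem_head //; move: ust; rewrite eq1 => /rcons_starts.
  by exists u; rewrite // inE mem_filter u0 u1 uL' orbT.
- move=> u xi; rewrite inE mem_filter; case: eqP => [-> _|_ /= /andP[_ uL']].
    exact: g2x.
  exact: g2f.
Qed.

Lemma swaps_generate g : H g.
Proof.
have [N gN] := thompson_uniform g.
have /choice[f gf] : forall u, exists u', size u = N ->
    forall xi, g (prepend u xi) = prepend u' xi.
  move=> u; have [/eqP/gN[u' gu]|neq_u] := boolP (size u == N); first by exists u'.
  by exists [::] => eq_u; rewrite eq_u eqxx in neq_u.
apply: (@partition_spanned _ (words N) f g (leqnn _)); first exact: uniq_words.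
- move=> u v; rewrite !mem_words => /eqP su /eqP sv.
  by rewrite perp_size // su sv.
- move=> xi; exists (mkseq xi N); first by rewrite mem_words size_mkseq.
  by rewrite /starts size_mkseq.
- by move=> u xi; rewrite mem_words => /eqP su; apply: gf.
Qed.

End Swaps.

(** * The sets [gens m] produce all cone swaps *)

Lemma krotK3 x : krot (krot (krot x)) = x.
Proof. by case: x => [[] []]. Qed.

(** Level transitivity of the Grigorchuk group. Below [true], the conjugate of [c] by [a] acts as
    the flip, and [krot (krot x)] acts as [x]. *)
Lemma word_reach m (U : seq bool -> Prop) : U (wroot m) ->
  (forall v, size v = m -> U v -> U (wflip v)) ->
  (forall x v, size v = m -> U v -> U (wact x v)) ->
  forall v, size v = m -> U v.
Proof.
elim: m U => [|m IHm] U U1 Uflip Uact; first by move=> v /size0nil ->.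
have Ut : forall v, size v = m -> U (true :: v).
  apply: (IHm (fun v => U (true :: v))) => // [v sv Uv|x v sv Uv].
    have := Uflip _ _ (Uact (true, false) _ _ (Uflip _ _ Uv)).
    by rewrite /= size_wflip sv; apply.
  by rewrite -[x]krotK3; apply: (Uact (krot (krot x)) (true :: v)); rewrite /= ?sv.
case=> // -[] v [sv]; first exact: Ut.
by apply: (Uflip (true :: v)); [rewrite /= sv | apply: Ut].
Qed.

Definition wend m := rcons (nseq m.-1 true) false.

Lemma size_wend m : 0 < m -> size (wend m) = m.
Proof. by case: m => // m _; rewrite size_rcons size_nseq. Qed.

Lemma wact_end m x : wact x (wend m) = wend m.
Proof.
rewrite /wend; elim: m.-1 x => [|n IHn] x /=; first by rewrite if_same.
by rewrite IHn.
Qed.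

Lemma wend_root m : 0 < m -> wend m != wroot m.
Proof.
by case: m => // m _; rewrite /wend /=; elim: m.
Qed.

Lemma cact_end m : 0 < m ->
  exists x, forall xi, cact m x (prepend (wend m) xi) = prepend (wend m) (cflip xi).
Proof.
case: m => // m _; elim: m => [|m [x xE]].
  by exists (true, false) => xi; rewrite cact_cons.
exists (krot (krot x)) => xi; have -> : wend m.+2 = true :: wend m.+1 by [].
by rewrite [in LHS]prepend_cons cact_cons krotK3 xE -prepend_cons.
Qed.

Section Generation.
Variable m : nat.
Hypothesis m_gt1 : 1 < m.
Let H := spanned (gens m).
Let m_gt0 : 0 < m. Proof. exact: ltnW. Qed.
Let HM g h : H g -> H h -> H (g * h)%g. Proof. exact: spannedM. Qed.
Let HV g : H g -> H g^-1%g. Proof. exact: spannedV. Qed.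
Let Hl l : H (lactV m l). Proof. exact/spanned_gen/mem_gens. Qed.
Let rt := wroot m.
Let size_rt : size rt = m. Proof. exact: size_nseq. Qed.

Let flip_rt : wflip rt != rt.
Proof. by rewrite /rt; case: (m) m_gt0. Qed.
Let flip_rt_end : wflip rt != wend m.
Proof. by rewrite /rt; case: (m) m_gt1 => [|[]]. Qed.

Let perp_words u v y z : size u = m -> size v = m -> u != v -> perp (u ++ y) (v ++ z).
Proof. by move=> su sv neq; apply: perp_cat; rewrite perp_size // su sv. Qed.

Let Hcell c d : H (sw (cellword m c) (cellword m d)).
Proof.
rewrite (_ : sw _ _ = lactV m (Some (inr (c, d)))); first exact: Hl.
exact: thompsonVP.
Qed.

Let off z := forall a, H (sw (rt ++ leaf a) z).

(** Propagation along the path by conjugation. Klein letters fix the root; the flip exchanges it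
    with its neighbour, and a generating swap moves it back. *)
Let off_leaf v b : size v = m -> v != rt -> off (v ++ leaf b).
Proof.
move=> sv v_rt; suff: v = rt \/ forall b, off (v ++ leaf b).
  by case=> [eqv|]; [rewrite eqv eqxx in v_rt | apply].
move: v sv {v_rt b}; apply: word_reach; first by left.
  move=> v sv Uv; have [->|v_rt] := eqVneq v rt.
    by right=> b a; apply: (Hcell (false, a) (true, b)).
  have [->|v_rt'] := eqVneq v (wflip rt); first by left; rewrite wflipK.
  have fv_rt : wflip v != rt by rewrite wflip_root_eq.
  have fv_rt' : wflip v != wflip rt by apply: contra v_rt => /eqP /(can_inj wflipK) ->.
  case: Uv => [eqv|Uv]; first by rewrite eqv eqxx in v_rt.
  right=> b a; have szf := size_wflip; have flipE u y xi : size u = m ->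
      cflip (prepend (u ++ y) xi) = prepend (wflip u ++ y) xi.
    by case: u => [|s u] su; [have := m_gt0; rewrite -su | rewrite cflip_prepend].
  have Ha : H (sw (wflip rt ++ leaf a) (wflip v ++ leaf b)).
    apply: (sw_conj_closed HM HV (Hl None) _ _ _ (Uv b a)) => [|xi|xi].
    - by apply: perp_words => //; rewrite eq_sym.
    - exact: flipE.
    - exact: flipE.
  apply: (sw_conj_closed HM HV (Hcell (false, a) (true, a)) _ _ _ Ha) => [|xi|xi].
  - by apply: perp_words; rewrite ?szf // eq_sym.
  - by rewrite /= swapf_r //; apply: perp_words; rewrite ?szf // eq_sym.
  - by rewrite /= swapf_perp //; apply: perp_words; rewrite ?szf // eq_sym.
move=> x v sv Uv; have [->|v_rt] := eqVneq v rt; first by left; rewrite wact_root.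
case: Uv => [eqv|Uv]; first by rewrite eqv eqxx in v_rt.
have [eqe|v_end] := eqVneq v (wend m); first by right; rewrite eqe wact_end -eqe.
right=> b a; apply: (sw_conj_closed HM HV (Hl (Some (inl x))) _ _ _ (Uv b a)) => [|xi|xi].
- by apply: perp_words => //; rewrite eq_sym.
- rewrite -[lactV m _ _]/(cact m x (prepend (rt ++ leaf a) xi)) prepend_cat.
  rewrite cact_inner ?wact_root -?prepend_cat //.
  by have := wend_root m_gt0; rewrite eq_sym.
- rewrite -[lactV m _ _]/(cact m x (prepend (v ++ leaf b) xi)) prepend_cat.
  by rewrite cact_inner // -prepend_cat.
Qed.

(* Only here do the generators break the partition into the cones
   [v ++ leaf a]. *)
Let off_end_flip s y : off (wend m ++ s :: y) -> off (wend m ++ ~~ s :: y).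
Proof.
have [x xE] := cact_end m_gt0; have end_rt := wend_root m_gt0.
move=> offy a; apply: (sw_conj_closed HM HV (Hl (Some (inl x))) _ _ _ (offy a)) => [|xi|xi].
- by apply: perp_words; rewrite ?size_wend // eq_sym.
- rewrite -[lactV m _ _]/(cact m x (prepend (rt ++ leaf a) xi)) prepend_cat.
  by rewrite cact_inner ?wact_root -?prepend_cat // eq_sym.
- rewrite -[lactV m _ _]/(cact m x (prepend (wend m ++ s :: y) xi)) !prepend_cat.
  by rewrite xE cflip_prepend.
Qed.

Let off_end s : off (wend m ++ [:: false; s]).
Proof.
apply: (off_end_flip (s := true) (y := [:: s])).
by apply: (@off_leaf _ (Some s)); rewrite ?size_wend ?wend_root.
Qed.

Let off_sw v y v' y' : size v = m -> size v' = m -> v != rt -> v' != rt ->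
  perp (v ++ y) (v' ++ y') -> off (v ++ y) -> off (v' ++ y') ->
  H (sw (v ++ y) (v' ++ y')).
Proof.
move=> sv sv' v_rt v_rt' pp offv offv'.
rewrite -[v' ++ y']cats0; apply: (@sw_trans _ HM HV _ (rt ++ leaf None)) => //.
- exact: perp_words.
- by apply: perp_words; rewrite // eq_sym.
- by rewrite cats0 sw_sym.
Qed.

(** Swapping [u ++ [:: false]] with [v ++ leaf y ++ w] carries children to children, so one level of
    extra depth at [u] yields any depth elsewhere. *)
Let off_refine u v y w : size u = m -> u != rt -> (forall s, off (u ++ [:: false; s])) ->
  size v = m -> v != rt -> v != u -> off (v ++ leaf y ++ w) ->
  forall s, off (v ++ leaf y ++ rcons w s).
Proof.
move=> su u_rt offu sv v_rt vu offv s a; rewrite -cats1 !catA.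
apply: (@sw_trans _ HM HV _ (u ++ [:: false])); rewrite -?catA.
- by apply: perp_words; rewrite // eq_sym.
- by apply: perp_words; rewrite // eq_sym.
- by apply: perp_words; rewrite // eq_sym.
- exact: offu.
- apply: off_sw => //; first by apply: perp_words; rewrite // eq_sym.
  exact: (@off_leaf _ (None)).
Qed.

Let off_extend u : size u = m -> u != rt -> (forall s, off (u ++ [:: false; s])) ->
  forall v, size v = m -> v != rt -> v != u -> forall y, 1 < size y -> off (v ++ y).
Proof.
move=> su u_rt offu v sv v_rt vu y sy.
suff ext b w : off (v ++ leaf b ++ w).
  by case: y sy => [|[] [|s w]] // _; [apply: (ext (Some s)) | apply: (ext None (s :: w))].
elim/last_ind: w => [|w s IHw]; first by rewrite cats0; apply: off_leaf.
exact: (off_refine su u_rt offu).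
Qed.

(** The end of the path gives depth to all other vertices; then the neighbour of the root gives it
    back to the end. *)
Let off_all v : size v = m -> v != rt -> forall y, 1 < size y -> off (v ++ y).
Proof.
move=> sv v_rt y sy; have end_rt := wend_root m_gt0; have se := size_wend m_gt0.
have [eqv|v_flip] := eqVneq v (wflip rt).
  by apply: (off_extend se end_rt off_end) => //; rewrite eqv.
apply: (@off_extend (wflip rt)) => //; first by rewrite size_wflip.
by move=> s; apply: (off_extend se end_rt off_end) => //; rewrite size_wflip.
Qed.

Let third v : exists2 u, size u = m & (u != rt) && (u != v).
Proof.
have [->|neq] := eqVneq v (wflip rt).
  by exists (wend m); rewrite ?size_wend ?wend_root //= eq_sym.
by exists (wflip rt); rewrite ?size_wflip // flip_rt eq_sym.
Qed.

(** A third vertex [u] serves as intermediate place: the word is moved from below [u] to below the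
    root. *)
Let sw_root_word y v' y' : size v' = m -> v' != rt -> 1 < size y -> 1 < size y' ->
  H (sw (v' ++ y') (rt ++ y)).
Proof.
move=> sv' v_rt' sy sy'; have [u su /andP[u_rt uv]] := third v'.
suff ext b w : H (sw (v' ++ y') (rt ++ leaf b ++ w)).
  by case: y sy => [|[] [|s w]] // _; [apply: (ext (Some s)) | apply: (ext None (s :: w))].
rewrite catA; apply: (@sw_trans _ HM HV _ (u ++ [:: false])); rewrite -?catA.
- by apply: perp_words; rewrite // eq_sym.
- exact: perp_words.
- exact: perp_words.
- apply: off_sw => //; first by apply: perp_words; rewrite // eq_sym.
  + exact: off_all.
  + by case: w => [|s w]; [apply: (@off_leaf _ (None)) | apply: off_all].
- by rewrite sw_sym; apply: (@off_leaf _ (None)).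
Qed.

Let sw_deep p q : perp p q -> m + 2 <= size p -> m + 2 <= size q -> H (sw p q).
Proof.
move=> pq sp sq.
rewrite -(cat_take_drop m p) -(cat_take_drop m q) in pq sp sq *.
have : size (take m p) = m by rewrite size_takel //; move: sp; rewrite cat_take_drop; lia.
have : size (take m q) = m by rewrite size_takel //; move: sq; rewrite cat_take_drop; lia.
move: (take m p) (drop m p) (take m q) (drop m q) pq sp sq => v y v' y'.
rewrite !size_cat => pp sp sq sv' sv.
have [sy sy'] : 1 < size y /\ 1 < size y' by lia.
have [eqv|v_rt] := eqVneq v rt; have [eqv'|v_rt'] := eqVneq v' rt.
(* Both words lie below the root: pass through a word below its neighbour. *)
- subst v v'; have sf : size (wflip rt) = m by rewrite size_wflip.
  rewrite -[rt ++ y']cats0.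
  apply: (@sw_trans _ HM HV _ (wflip rt ++ [:: false; false])) => //.
  + by apply: perp_words; rewrite // eq_sym.
  + exact: perp_words.
  + by rewrite cats0 sw_sym; apply: sw_root_word.
  + exact: sw_root_word.
- by rewrite eqv sw_sym; apply: sw_root_word.
- by rewrite eqv'; apply: sw_root_word.
- by apply: off_sw => //; apply: off_all.
Qed.

Let sw_all p q : perp p q -> H (sw p q).
Proof.
(* Cones are split until each word has a vertex and two more letters, the length of the longest
   leaf. *)
suff ind d : forall p q, perp p q -> m + 2 <= size p + d -> m + 2 <= size q + d ->
    H (sw p q).
  by move=> pq; apply: (ind (m + 2)) => //; apply: leq_addl.
elim: d => [|d IHd] {}p {}q pq; first by rewrite !addn0; apply: sw_deep.
move=> sp sq; rewrite (sw_children pq); apply: HM; apply: IHd.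
all: rewrite ?size_rcons -?cats1; by [apply: perp_cat | lia].
Qed.

Lemma gens_generating : generating (gens m).
Proof.
move=> g; apply: (@swaps_generate H) => //; exact: spanned1.
Qed.

End Generation.

Import Order.TTheory GRing.Theory Num.Theory numFieldNormedType.Exports.

(** * Growth rates *)

Section Fekete.
Variables (G : groupType) (S : {fset G}).
Local Open Scope group_scope.

Lemma word_ballD m n g : word_ball S (m + n) g ->
  exists h k, [/\ word_ball S m h, word_ball S n k & g = h * k].
Proof.
move=> [w [Sw le_w ->]]; exists (\prod_(s <- take m w) s), (\prod_(s <- drop m w) s).
move: Sw; rewrite -{1}(cat_take_drop m w) /word_over all_cat => /andP[Sv Su].
split; last by rewrite -big_cat cat_take_drop.
  by exists (take m w); split; rewrite ?size_take_min ?geq_minl.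
by exists (drop m w); split; rewrite // size_drop leq_subLR.
Qed.

Lemma growthD m n : (growth S (m + n) <= growth S m * growth S n)%N.
Proof.
set A := fset_set (word_ball S m); set B := fset_set (word_ball S n).
have sub : {subset fset_set (word_ball S (m + n)) <= [seq x * y | x <- A, y <- B]}.
  move=> g; rewrite in_fset_set; last exact: finite_word_ball.
  rewrite inE => /word_ballD[h [k [hm kn ->]]]; apply: allpairs_f.
    by rewrite in_fset_set ?inE //; apply: finite_word_ball.
  by rewrite in_fset_set ?inE //; apply: finite_word_ball.
by apply: leq_trans (uniq_leq_size (fset_uniq _) sub) _; rewrite size_allpairs.
Qed.

Lemma growth_mono m n : (m <= n)%N -> (growth S m <= growth S n)%N.
Proof.
move=> le_mn; apply: fsubset_leq_card; apply/fsubsetP => g.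
rewrite !in_fset_set; try exact: finite_word_ball.
rewrite !inE => -[w [Sw le_w ->]]; exists w; split=> //.
exact: leq_trans le_mn.
Qed.

Lemma growth_gt0 n : (0 < growth S n)%N.
Proof.
rewrite cardfs_gt0; apply/fset0Pn; exists 1.
rewrite in_fset_set; last exact: finite_word_ball.
by rewrite inE; exists [::]; rewrite big_nil.
Qed.

Lemma growthM n q : (growth S (q * n) <= growth S n ^ q)%N.
Proof.
elim: q => [|q IHq]; last first.
  by rewrite mulSn expnS (leq_trans (growthD _ _)) // leq_mul2l IHq orbT.
rewrite mul0n expn0 /growth.
have sub : {subset fset_set (word_ball S 0) <= [:: (1 : G)]}.
  move=> g; rewrite in_fset_set; last exact: finite_word_ball.
  rewrite inE => -[w [_ + ->]]; rewrite leqn0 size_eq0 => /eqP ->.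
  by rewrite big_nil inE.
exact: (uniq_leq_size (fset_uniq _) sub).
Qed.

Variable R : realType.
Local Open Scope ring_scope.
Local Open Scope classical_set_scope.

Let u n : R := (growth S n)%:R `^ n%:R^-1.

Let gr_ge1 n : 1 <= (growth S n)%:R :> R.
Proof. by rewrite ler1n growth_gt0. Qed.

Let u_ge1 n : 1 <= u n.
Proof.
by rewrite -[1](powRr0 (growth S n)%:R) ler_powR // invr_ge0.
Qed.

Lemma cvg_powR_inv (a : R) : 0 < a -> (fun n => a `^ n%:R^-1) @ \oo --> (1 : R).
Proof.
move=> a_gt0; rewrite (_ : (fun n => _) = expR \o (fun n : nat => n%:R^-1 * ln a)); last first.
  by apply/funext => n; rewrite /powR /= gt_eqF.
rewrite -[X in _ --> X](@expR0 R).
apply: continuous_cvg; first exact: continuous_expR.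
rewrite -[X in _ --> X](mul0r (ln a)); apply: cvgMl; apply/gtr0_cvgV0; last exact: cvgr_idn.
by near=> n; rewrite ltr0n; near: n; exists 1%N.
Unshelve. all: by end_near. Qed.

(** Submultiplicativity: a ball of radius [n] is covered by [n %/ N + 1] factors of radius [N]. *)
Let u_le N n : (0 < N)%N -> (0 < n)%N -> u n <= u N * (growth S N)%:R `^ n%:R^-1.
Proof.
move=> N_gt0 n_gt0; rewrite /u; set a := (growth S N)%:R.
have a_ge1 : 1 <= a := gr_ge1 N.
have a_neq0 : a != 0 by rewrite gt_eqF // (lt_le_trans ltr01).
have le_gr : (growth S n)%:R <= a `^ (n %/ N).+1%:R.
  rewrite powR_mulrn ?(le_trans ler01) // -natrX ler_nat.
  apply: leq_trans (growthM _ _); apply: growth_mono.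
  by rewrite ltnW // ltn_ceil.
apply: (@le_trans _ _ ((a `^ (n %/ N).+1%:R) `^ n%:R^-1)).
  by rewrite ge0_ler_powR ?nnegrE ?powR_ge0 // ?invr_ge0 // (le_trans ler01).
rewrite -powRrM -powRD; last by rewrite a_neq0 implybT.
rewrite ler_powR // -natr1 mulrDl mul1r lerD2r ler_pdivrMr ?ltr0n //.
by rewrite mulrC ler_pdivlMr ?ltr0n // -natrM ler_nat leq_trunc_div.
Qed.

Let u_bound_cvg N :
  (fun n => u N * (growth S N)%:R `^ n%:R^-1) @ \oo --> u N.
Proof.
rewrite -[X in _ --> X]mulr1; apply: cvgM; first exact: cvg_cst.
by apply: cvg_powR_inv; rewrite ltr0n growth_gt0.
Qed.

(** Fekete's lemma; it makes the limit in [growth_rate] meaningful. *)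
Let u_cvg : cvgn u.
Proof.
(* Index 0 is left out: the inverse of 0 is 0, so [u 0 = 1] regardless of the growth. *)
pose E := [set u n | n in [set n | (0 < n)%N]].
have lbE : lbound E 1 by move=> _ [n _ <-]; apply: u_ge1.
have infE : has_inf E by split; [exists (u 1), 1%N | exists 1].
apply/cvg_ex; exists (inf E); apply/cvgrPdist_lt => e e_gt0.
have [_ [N N_gt0 <-] ltN] := inf_adherent e_gt0 infE.
have near_lt := cvgr_lt _ (@u_bound_cvg N) _ ltN; near=> n.
have n_gt0 : (0 < n)%N by near: n; exists 1%N.
have le_u : inf E <= u n by apply: ge_inf; [case: infE | exists n].
rewrite ler0_norm ?subr_le0 // opprB ltrBlDl.
apply: le_lt_trans (u_le N_gt0 n_gt0) _; near: n; exact: near_lt.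
Unshelve. all: by end_near. Qed.

Lemma growth_rate_le N : (0 < N)%N -> growth_rate R S <= (growth S N)%:R `^ N%:R^-1.
Proof.
move=> N_gt0.
rewrite -[leRHS](cvg_lim _ (@u_bound_cvg N)) //.
apply: ler_lim => //; first by apply/cvg_ex; exists (u N).
near=> n; apply: u_le => //; near: n; by exists 1%N.
Unshelve. all: by end_near. Qed.

Lemma growth_rate_ge (c : R) :
  (forall n, (0 < n)%N -> c <= (growth S n)%:R `^ n%:R^-1) -> c <= growth_rate R S.
Proof.
move=> le_c; apply: limr_ge => //; near=> n; apply: le_c; near: n; by exists 1%N.
Unshelve. all: by end_near. Qed.

Lemma growth_rate_ge1 : 1 <= growth_rate R S.
Proof. by apply: growth_rate_ge => n _; apply: u_ge1. Qed.

End Fekete.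

(** * A free semigroup in V and exponential growth *)

Section Exponential.
Local Open Scope group_scope.

(* [half b] maps the cone of [0] onto the cone of [0b], so that the elements
   [half false] and [half true] generate a free semigroup. *)
Definition half b : thompsonV :=
  sw [:: true; false] [:: false; b] * sw [:: false] [:: true; false].

Lemma thompson_mulE (g h : thompsonV) xi : (g * h) xi = g (h xi).
Proof. by []. Qed.

Lemma prod_half v xi : (\prod_(g <- map half v) g) (prepend [:: false] xi) =
  prepend (false :: v) xi.
Proof.
elim: v xi => [|b v IHv] xi; first by rewrite big_nil.
rewrite [map _ _]/= big_cons thompson_mulE IHv thompson_mulE.
rewrite prepend_cons -[sw _ _ (prepend _ _)]/(swapf _ _ _) -[LHS]/(swapf _ _ _).
by rewrite swapf_l // swapf_l // -prepend_cat.
Qed.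

Lemma growth_half (S : {fset thompsonV}) n :
  (forall b, half b \in S) -> (2 ^ n <= growth S n)%N.
Proof.
move=> Shalf; rewrite -size_words -(size_map (fun v => \prod_(g <- map half v) g)).
apply: uniq_leq_size => [|g /mapP[v]].
  rewrite map_inj_in_uniq ?uniq_words // => v w.
  rewrite !mem_words => /eqP sv /eqP szw eqvw.
  have := prod_half v (fun=> false); rewrite eqvw prod_half => /prepend_eq.
  by rewrite /= sv szw ltnSn => /(_ isT)[]; rewrite -sv take_size.
rewrite mem_words => /eqP sv ->.
rewrite in_fset_set; last exact: finite_word_ball.
rewrite inE; exists (map half v); split; rewrite ?size_map ?sv //.
by apply/allP => _ /mapP[b _ ->]; rewrite Shalf.
Qed.

End Exponential.

Lemma generating_sub (G : groupType) (S T : {fset G}) :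
  {subset S <= T} -> generating S -> generating T.
Proof.
move=> ST genS g; have [w Sw ->] := genS g; exists w => //.
by apply: sub_all Sw => s /orP[] /ST ->; rewrite ?orbT.
Qed.

(** * Growth rate and infimal growth rate of V *)

Section Main.
Variable R : realType.
Local Open Scope ring_scope.

(** One ball bounds the rate: radius [N] gives at most [2 ^ L] elements, with [j.+1 * L <= N]. *)
Lemma growth_gens_rate j : exists2 k, (1 < k)%N &
  growth_rate R (gens (k + k)) <= 2 `^ j.+1%:R^-1.
Proof.
have [k k_gt1] := budget_small j.+1.
move: (growth_gens k_gt1); set N := (2 ^ (k + k - 2))%N.
set L := (k * _ + _)%N => le_growth le_N; exists k => //.
have N_gt0 : (0 < N)%N by rewrite expn_gt0.
apply: le_trans (growth_rate_le _ R N_gt0) _.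
apply: (@le_trans _ _ ((2 `^ L%:R) `^ N%:R^-1)).
  rewrite ge0_ler_powR ?nnegrE ?powR_ge0 ?invr_ge0 //.
  by rewrite powR_mulrn // -natrX ler_nat.
rewrite -powRrM ler_powR ?ler1n // ler_pdivrMr ?ltr0n //.
by rewrite mulrC ler_pdivlMr ?ltr0n // -natrM ler_nat mulnC.
Qed.

Lemma thompson_exponential_growth : exponential_growth thompsonV R.
Proof.
(* Adjoining both elements [half b] to a generating set forces balls of size at least [2 ^ n]. *)
pose S := (gens 2 `|` [fset half b | b in {: bool}])%fset.
exists S.
  by apply: generating_sub (gens_generating (ltnSn 1)) => g; rewrite inE => ->.
have Shalf b : half b \in S by rewrite inE [X in _ || X]in_imfset ?orbT.
apply: (@lt_le_trans _ _ 2); first by rewrite ltr1n.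
apply: growth_rate_ge => n n_gt0.
have -> : 2 = (2 `^ n%:R) `^ n%:R^-1 :> R.
  by rewrite -powRrM mulfV ?powRr1 // pnatr_eq0 -lt0n.
rewrite ge0_ler_powR ?nnegrE ?powR_ge0 ?invr_ge0 //.
by rewrite powR_mulrn // -natrX ler_nat growth_half.
Qed.

Lemma thompson_infimal_growth_rate : infimal_growth_rate thompsonV R = 1.
Proof.
have lbE : lbound [set growth_rate R S | S in @generating thompsonV] 1.
  by move=> _ [S _ <-]; apply: growth_rate_ge1.
apply/le_anti/andP; split; last first.
  apply: lb_le_inf => //; exists (growth_rate R (gens 2)), (gens 2) => //.
  exact: gens_generating.
have cvg2 : (fun j => (2 : R) `^ j.+1%:R^-1) @ \oo --> (1 : R).
  have := @cvg_powR_inv R 2 (ltr0n _ 2); rewrite -cvg_shiftS; exact.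
rewrite -[leRHS](cvg_lim _ cvg2) //; apply: limr_ge; first by apply/cvg_ex; exists 1.
near=> j; have [k k_gt1 le_rate] := growth_gens_rate j.
apply: le_trans le_rate; apply: ge_inf; first by exists 1.
exists (gens (k + k)) => //; apply: gens_generating.
by rewrite (leq_trans k_gt1) // leq_addr.
Unshelve. all: by end_near. Qed.

End Main.

Theorem theorem1 (R : realType) : nonuniform_exponential_growth thompsonV R.
Proof.
split; last exact: thompson_infimal_growth_rate.
  by exists (gens 2); apply: gens_generating.
exact: thompson_exponential_growth.
Qed.
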